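(* Let $N\ge 2$, $\xi>0$, and consider the system of $N$ agents in the plane with $n=1$ (each agent interacts only with its single closest neighbor, with isotropic attraction and repulsion), i.e. $\dot x(t)=f(x(t))$ with $f$ as defined in the context. Then for any initial condition $x^0\in(\mathbb{R}^2)^N\setminus S$, this equation has at least one Filippov solution $x:\mathbb{R}_{\ge 0}\to(\mathbb{R}^2)^N$ such that $x(0)=x^0$ and $x(t)\in(\mathbb{R}^2)^N\setminus S$ for every $t>0$.
   Context: Configurations are $x=(x_1,\dots,x_N)\in(\mathbb{R}^2)^N$, where $x_i$ is the position of agent $i$, and $\|\cdot\|$ is the Euclidean norm on $\mathbb{R}^2$. The set of degenerate configurations is $S=\{x: \exists\, i\neq j \text{ with } x_i=x_j\}$, and the set of switching configurations is $D=\{x:\exists\, i,j,k\in\{1,\dots,N\} \text{ (with } j\ne k, j,k\ne i) \text{ s.t. } \|x_i-x_j\|=\|x_i-x_k\|\}$. For $x\notin D\cup S$, each agent $i$ has a unique closest neighbor $c_i(x)=\arg\min_{j\neq i}\|x_i-x_j\|$, and the vector field $f:(\mathbb{R}^2)^N\setminus(D\cup S)\to(\mathbb{R}^2)^N$ is defined componentwise by $$f_i(x)=\big(x_{c_i(x)}-x_i\big)-\xi^2\,\frac{x_{c_i(x)}-x_i}{\|x_{c_i(x)}-x_i\|^2},\qquad i=1,\dots,N.$$ For $y\in(\mathbb{R}^2)^N$, set $K f(y)=\bigcap_{\delta>0}\bigcap_{\mu(\Lambda)=0}\overline{\mathrm{co}}\{f(B(y,\delta)\setminus\Lambda)\}$,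 where $B(y,\delta)$ is the open Euclidean ball of radius $\delta$ centered at $y$, $\overline{\mathrm{co}}$ denotes the closed convex hull, $\mu$ is Lebesgue measure, and the inner intersection is over all Lebesgue-null sets $\Lambda$ (points where $f$ is undefined are discarded). A map $x:\mathbb{R}_{\ge0}\to(\mathbb{R}^2)^N$ is a Filippov solution of $\dot x=f(x)$ if it is absolutely continuous and $\dot x(t)\in K f(x(t))$ for almost every $t>0$. *)

(* Defs.v *)
From HB Require Import structures.
From mathcomp Require Import all_boot all_order all_algebra.
From mathcomp Require Import all_classical all_reals all_analysis.
Set Implicit Arguments. Unset Strict Implicit. Unset Printing Implicit Defensive.
Import Order.TTheory GRing.Theory Num.Theory.
Import numFieldNormedType.Exports.
Local Open Scope classical_set_scope.
Local Open Scope ring_scope.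

(* A configuration x = (x_1,...,x_N) in (R^2)^N: x i k = k-th coordinate of agent i. *)
Definition config (R : realType) (N : nat) := 'I_N -> 'I_2 -> R.

Definition agent_dist (R : realType) (N : nat) (x : config R N) (i j : 'I_N) : R :=
  Num.sqrt (\sum_(k < 2) (x i k - x j k) ^+ 2).

Definition cfg_norm (R : realType) (N : nat) (y : config R N) : R :=
  Num.sqrt (\sum_(i < N) \sum_(k < 2) (y i k) ^+ 2).

Definition cfg_sub (R : realType) (N : nat) (x y : config R N) : config R N :=
  fun i k => x i k - y i k.

Definition cfg_ball (R : realType) (N : nat) (y : config R N) (delta : R) : set (config R N) :=
  [set x | cfg_norm (cfg_sub x y) < delta].

Definition degenerate (R : realType) (N : nat) : set (config R N) :=
  [set x | exists i j : 'I_N, i != j /\ forall k, x i k = x j k].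

Definition switching (R : realType) (N : nat) : set (config R N) :=
  [set x | exists i j k : 'I_N, [/\ j != k, j != i, k != i &
             agent_dist x i j = agent_dist x i k]].

Definition is_closest (R : realType) (N : nat) (x : config R N) (i j : 'I_N) : Prop :=
  j != i /\ forall l : 'I_N, l != i -> l != j -> agent_dist x i j < agent_dist x i l.

Definition f_formula (R : realType) (N : nat) (xi : R) (x : config R N) (c : 'I_N -> 'I_N)
  : config R N :=
  fun i k => (x (c i) k - x i k)
             - xi ^+ 2 * (x (c i) k - x i k) / (agent_dist x i (c i)) ^+ 2.

(* graph of f : (R^2)^N \ (D u S) -> (R^2)^N;  f_graph xi x v  <->  x is in the
   domain of f and f(x) = v  (with c_i(x) the closest neighbour of i). *)
Definition f_graph (R : realType) (N : nat) (xi : R) (x v : config R N) : Prop :=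
  ~ degenerate x /\ ~ switching x /\
  exists c : 'I_N -> 'I_N, (forall i, is_closest x i (c i)) /\
    forall i k, v i k = f_formula xi x c i k.

(* Lebesgue-null subsets of (R^2)^N = R^{2N}: coverable by countably many closed
   boxes of arbitrarily small total volume. *)
Definition cfg_null (R : realType) (N : nat) (L : set (config R N)) : Prop :=
  forall eps : R, 0 < eps ->
  exists a b : nat -> config R N,
    [/\ (forall m i k, a m i k <= b m i k),
        L `<=` \bigcup_m [set x | forall i k, a m i k <= x i k <= b m i k] &
        forall n, \sum_(m < n) \prod_(i < N) \prod_(k < 2) (b m i k - a m i k) <= eps].

Definition cfg_conv (R : realType) (N : nat) (A : set (config R N)) : set (config R N) :=
  [set v | exists n (p : 'I_n -> config R N) (w : 'I_n -> R),
     [/\ (forall j, A (p j)), (forall j, 0 <= w j), \sum_(j < n) w j = 1 &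
         forall i k, v i k = \sum_(j < n) w j * p j i k]].

Definition cfg_clconv (R : realType) (N : nat) (A : set (config R N)) : set (config R N) :=
  [set v | forall eps : R, 0 < eps -> exists u, cfg_conv A u /\ cfg_norm (cfg_sub u v) < eps].

Definition Kf (R : realType) (N : nat) (xi : R) (y : config R N) : set (config R N) :=
  [set v | forall delta : R, 0 < delta -> forall L : set (config R N), cfg_null L ->
     cfg_clconv [set u | exists x, [/\ cfg_ball y delta x, ~ L x & f_graph xi x u]] v].

Definition abs_cont_on (R : realType) (a b : R) (g : R -> R) : Prop :=
  forall eps : R, 0 < eps -> exists2 delta : R, 0 < delta &
    forall n (s t : 'I_n -> R),
      (forall j, a <= s j /\ s j <= t j /\ t j <= b) ->
      (forall j l, j != l -> t j <= s l \/ t l <= s j) ->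
      \sum_(j < n) (t j - s j) < delta ->
      \sum_(j < n) `|g (t j) - g (s j)| < eps.

(* Filippov solution on R_{>=0} (only the values on [0, +oo) matter):
   absolutely continuous on every compact [0, T], and for a.e. t > 0 the derivative
   exists and lies in K f (x(t)). *)
Definition filippov_solution (R : realType) (N : nat) (xi : R) (x : R -> config R N) : Prop :=
  (forall T : R, 0 < T -> forall i k, abs_cont_on 0 T (fun t => x t i k)) /\
  exists Z : set R, (@lebesgue_measure R).-negligible Z /\
    forall t : R, 0 < t -> ~ Z t ->
      exists v : config R N,
        (forall i k, is_derive t 1 (fun s => x s i k) (v i k)) /\ Kf xi (x t) v.

(* Main.v *)
Require Import Defs.
From HB Require Import structures.
From mathcomp Require Import all_boot all_order all_algebra.
From mathcomp Require Import all_classical all_reals all_analysis.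
From mathcomp Require Import ring lra zify.
Set Implicit Arguments. Unset Strict Implicit. Unset Printing Implicit Defensive.
Import Order.TTheory GRing.Theory Num.Theory.
Import numFieldNormedType.Exports.
Local Open Scope classical_set_scope.
Local Open Scope ring_scope.

(* A solution is obtained as a limit, along an ultrafilter, of Euler polygons
   x_(k+1) = x_k + h f(y_k), where y_k is a generic point very close to x_k.  At
   a point of differentiability of the Lipschitz limit, the difference quotients
   are limits of averages of values of f at nearby generic points, hence of
   convex combinations; since f is continuous near generic points, null sets do
   not matter and the derivative lies in K f.

   Collisions are excluded by choosing y_k well; an arbitrary Filippov velocity
   may shrink all the minimal distances at once.  The energy
   S(x) = sum_(i <> j) exp (- q d_ij) controls the minimal distance m, and its
   logarithmic derivative along u is - 2 q sum_i w_i . u_i, where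
   w_i = sum_j p_ij e_ij, e_ij is the unit vector from x_j to x_i and p_ij is
   proportional to exp (- q d_ij).  When m <= xi it suffices to find y near x
   such that sum_i w_i . e_(i, c_i(y)) is almost nonnegative.  Displace agent i
   by t z_i: the distances become, to first order, d_ij + t e_ij . (z_i - z_j).
   Let C be the polyhedron of the z for which all these remain >= m, and let
   theta_i(z) be the minimum over j of the excess over m.  Averaging over C with
   the density exp (- w . z), integration by parts along the line z_i + R w_i
   gives E [w_i . e_(i, c_i)] = |w_i|^2 E [theta_i] >= 0, because theta_i vanishes
   where that line enters C.  Hence some z does the job.  The integral is then
   replaced by a count of lattice points z_i = n_i w_i, the boundary terms being
   made negligible by a pigeonhole argument that yields uniform constants. *)

(** * Null sets have empty interior *)

Section null_sets.
Context {R : realType}.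

Definition overlap (a b l u : R) : R := Num.max 0 (Num.min b u - Num.max a l).

Lemma overlap_ge0 a b l u : 0 <= overlap a b l u.
Proof. by rewrite /overlap le_max lexx. Qed.

Lemma overlapE a b l u : a <= b -> l <= u ->
  overlap a b l u = Num.min b (Num.max a u) - Num.min b (Num.max a l).
Proof.
rewrite /overlap => ab lu.
by case: (leP b u) => ?; case: (leP a l) => ?; case: (leP a u) => ?; rewrite !maxEle !minEle;
  repeat (case: ifPn; rewrite -?ltNge => ?); lra.
Qed.

Lemma overlapD a b l c u : a <= b -> l <= c -> c <= u ->
  overlap a b l c + overlap a b c u = overlap a b l u.
Proof. by move=> ab lc cu; rewrite !overlapE ?(le_trans lc cu)//; ring. Qed.

Lemma overlap_le a b l u : a <= b -> overlap a b l u <= b - a.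
Proof.
rewrite /overlap => ab.
case: (leP b u) => ?; case: (leP a l) => ?; by rewrite !maxEle; repeat (case: ifPn; rewrite -?ltNge => ?); lra.
Qed.

Lemma overlap_sub a b l u : a <= l -> l <= u -> u <= b -> overlap a b l u = u - l.
Proof.
rewrite /overlap => ? ? ?.
case: (leP b u) => ?; case: (leP a l) => ?; by rewrite !maxEle; repeat (case: ifPn; rewrite -?ltNge => ?); lra.
Qed.

Lemma prod_fatten (J : Type) (s : seq J) (l : J -> R) (e : R) :
  (forall j, 0 <= l j) -> 0 < e ->
  exists2 t0, 0 < t0 & forall t, 0 < t <= t0 ->
    \prod_(j <- s) (l j + t) <= \prod_(j <- s) l j + e.
Proof.
move=> l0; elim: s e => [|j s IH] e e0.
  by exists 1 => // t _; rewrite !big_nil lerDl ltW.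
have P0 : 0 <= \prod_(j <- s) l j by apply: prodr_ge0.
set P := \prod_(j <- s) l j in P0.
have lj := l0 j.
have e'0 : 0 < e / (2 * (l j + 1)) by rewrite divr_gt0// mulr_gt0//; lra.
have [t1 t10 Ht1] := IH _ e'0.
set e' := e / _ in e'0 Ht1.
have e'E : e' * (l j + 1) = e / 2 by rewrite /e'; field; lra.
have t20 : 0 < e / (2 * (P + e')) by rewrite divr_gt0// mulr_gt0//; lra.
set t2 := e / _ in t20.
have t2E : t2 * (P + e') = e / 2 by rewrite /t2; field; lra.
exists (Num.min t1 t2); first by rewrite lt_min t10.
move=> t; rewrite le_min => /andP[t0 /andP[tt1 tt2]].
rewrite !big_cons -/P.
have H1 : \prod_(j0 <- s) (l j0 + t) <= P + e' by apply: Ht1; rewrite t0.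
apply: (@le_trans _ _ ((l j + t) * (P + e'))); first by rewrite ler_wpM2l//; lra.
have : t * (P + e') <= t2 * (P + e') by rewrite ler_wpM2r//; lra.
by rewrite t2E; nra.
Qed.

Lemma sum_geometric_half_le (e : R) n : 0 <= e -> \sum_(m < n) e / 2 ^+ m.+1 <= e.
Proof.
move=> e0; suff : \sum_(m < n) e / 2 ^+ m.+1 = e - e / 2 ^+ n.
  by move=> ->; rewrite lerBlDr lerDl divr_ge0// exprn_ge0.
elim: n => [|n IH]; first by rewrite big_ord0 expr0; field.
by rewrite big_ord_recr/= IH exprS; field; rewrite expf_neq0//; lra.
Qed.

Section bisection.
Variables (J : finType) (a b : nat -> J -> R).
Hypothesis ab : forall m j, a m j <= b m j.

(* A cube of which the boxes cover at most half of the volume has a dyadic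
   subcube with the same property; the nested cubes shrink to a point which is
   interior to none of the boxes. *)
Definition half_covered (l : J -> R) (s : R) := forall n,
  \sum_(m < n) \prod_j overlap (a m j) (b m j) (l j) (l j + s) <= s ^+ #|J| / 2.

Lemma bisect (l : J -> R) (s : R) : 0 < s -> half_covered l s ->
  exists f : {ffun J -> bool}, half_covered (fun j => l j + (f j)%:R * (s / 2)) (s / 2).
Proof.
move=> s0 H; apply: contrapT => /forallNP H1.
have {}H1 (f : {ffun J -> bool}) : exists n, (s / 2) ^+ #|J| / 2 <
  \sum_(m < n) \prod_j overlap (a m j) (b m j) (l j + (f j)%:R * (s / 2))
     (l j + (f j)%:R * (s / 2) + s / 2).
  by apply: contrapT => /forallNP H2; apply: (H1 f) => n; rewrite leNgt; apply/negP/H2.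
have [n0 Hn0] := choice H1.
pose n := (\max_f n0 f)%N.
have := H n; rewrite leNgt => /negP; apply.
have -> : \sum_(m < n) \prod_j overlap (a m j) (b m j) (l j) (l j + s) =
  \sum_(f : {ffun J -> bool}) \sum_(m < n) \prod_j
    overlap (a m j) (b m j) (l j + (f j)%:R * (s / 2)) (l j + (f j)%:R * (s / 2) + s / 2).
  rewrite exchange_big/=; apply: eq_bigr => m _.
  under eq_bigr => j _.
    have -> : overlap (a m j) (b m j) (l j) (l j + s) =
      \sum_(c : bool) overlap (a m j) (b m j) (l j + c%:R * (s / 2)) (l j + c%:R * (s / 2) + s / 2).
      rewrite big_bool/= mul1r mul0r addr0 addrC.
      rewrite -(@overlapD _ _ (l j) (l j + s / 2) (l j + s))//; [|lra|lra].
      by congr (_ + overlap _ _ _ _); lra.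
    over.
  by rewrite bigA_distr_bigA.
have -> : s ^+ #|J| / 2 = \sum_(f : {ffun J -> bool}) (s / 2) ^+ #|J| / 2.
  rewrite sumr_const card_ffun card_bool -[RHS]mulr_natl natrX expr_div_n.
  by field; rewrite expf_neq0//; lra.
apply: ltr_sum => [|f _]; first by apply/hasP; exists [ffun=> true]; rewrite ?mem_index_enum.
apply: (lt_le_trans (Hn0 f)).
rewrite (big_ord_widen n (fun m => \prod_j overlap (a m j) (b m j) _ _)); last first.
  by rewrite /n; apply: leq_bigmax.
by rewrite [leRHS](bigID (fun m : 'I_n => (m < n0 f)%N))/= lerDl; apply: sumr_ge0 => m _;
  apply: prodr_ge0 => j _; exact: overlap_ge0.
Qed.

Lemma nested_boxes (l0 : J -> R) (s : R) : 0 < s -> half_covered l0 s ->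
  exists x : J -> R, (forall j, l0 j <= x j <= l0 j + s) /\
   forall n, exists l, half_covered l (s / 2 ^+ n) /\
     forall j, l j <= x j <= l j + s / 2 ^+ n.
Proof.
move=> s0 H0.
have p2 n : 0 < s / 2 ^+ n by rewrite divr_gt0// exprn_gt0.
have H1 (nl : nat * (J -> R)) : exists f : {ffun J -> bool},
   half_covered nl.2 (s / 2 ^+ nl.1) ->
   half_covered (fun j => nl.2 j + (f j)%:R * (s / 2 ^+ nl.1.+1)) (s / 2 ^+ nl.1.+1).
  have [Hh|Hh] := pselect (half_covered nl.2 (s / 2 ^+ nl.1)); last by exists [ffun=> true].
  have [f Hf] := bisect (p2 nl.1) Hh; exists f => _.
  by rewrite exprSr invfM mulrA.
have [F HF] := choice H1.
pose lo := fix lo n := if n is m.+1 then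
   (fun j => lo m j + (F (m, lo m) j)%:R * (s / 2 ^+ m.+1)) else l0.
have Hlo n : half_covered (lo n) (s / 2 ^+ n).
  by elim: n => [|n IH]; [rewrite expr0 divr1|exact: (HF (n, lo n))].
have pS n : s / 2 ^+ n = 2 * (s / 2 ^+ n.+1).
  by rewrite exprS; field; rewrite expf_neq0//; lra.
have lo_le j n : lo n j <= lo n.+1 j.
  by rewrite /= lerDl mulr_ge0// ltW.
have hi_ge j n : lo n.+1 j + s / 2 ^+ n.+1 <= lo n j + s / 2 ^+ n.
  by rewrite [in leRHS]pS /=; have := p2 n.+1; case: (F _ j) => /=; lra.
have lo_mono j n m : (n <= m)%N -> lo n j <= lo m j.
  by move=> /subnK <-; elim: (m - n)%N => // k; rewrite addSn => /le_trans; apply.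
have hi_mono j n m : (n <= m)%N -> lo m j + s / 2 ^+ m <= lo n j + s / 2 ^+ n.
  by move=> /subnK <-; elim: (m - n)%N => // k; rewrite addSn; apply/le_trans/hi_ge.
have lohi j n m : lo n j <= lo m j + s / 2 ^+ m.
  have [nm|/ltnW mn] := leqP n m.
    by rewrite (le_trans (lo_mono j _ _ nm))// lerDl ltW.
  by apply: le_trans (hi_mono j _ _ mn); rewrite lerDl ltW.
pose x j := sup [set lo n j | n in setT].
have Hx j n : lo n j <= x j <= lo n j + s / 2 ^+ n.
  have hs : has_sup [set lo n j | n in setT].
    split; first by exists (lo 0%N j); exists 0%N.
    by exists (l0 j + s) => _ [m _ <-]; have := lohi j m 0%N; rewrite expr0 divr1.
  apply/andP; split; first by apply: ub_le_sup; [exact: hs.2|exists n].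
  by apply: ge_sup; [exact: hs.1|move=> _ [m _ <-]; exact: lohi].
exists x; split=> [j|n]; first by have := Hx j 0%N; rewrite expr0 divr1.
by exists (lo n); split=> // j.
Qed.

End bisection.

Lemma cfg_null_avoid N (L : set (config R N)) (y : config R N) (r : R) :
  cfg_null L -> 0 < r ->
  exists x, ~ L x /\ forall i k, `|x i k - y i k| <= r.
Proof.
move=> nL r0.
pose J := ('I_N * 'I_2)%type : finType.
pose e := r ^+ #|J| / 4.
have e0 : 0 < e by rewrite divr_gt0// exprn_gt0.
have [a [b [ab Lab sumab]]] := nL _ e0.
have Ht m : exists t, 0 < t /\ \prod_(j : J) (b m j.1 j.2 - a m j.1 j.2 + t) <=
   \prod_(j : J) (b m j.1 j.2 - a m j.1 j.2) + e / 2 ^+ m.+1.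
  have em : 0 < e / 2 ^+ m.+1 by rewrite divr_gt0// exprn_gt0.
  have [|t0 t00 H] := @prod_fatten J (index_enum J)
     (fun j => b m j.1 j.2 - a m j.1 j.2) _ _ em; first by move=> j; rewrite subr_ge0.
  by exists t0; split=> //; apply: H; rewrite t00 lexx.
have [t Htt] := choice Ht.
pose A m (j : J) := a m j.1 j.2 - t m / 2.
pose B m (j : J) := b m j.1 j.2 + t m / 2.
have AB m j : A m j <= B m j.
  by rewrite /A /B; have := ab m j.1 j.2; have [+ _] := Htt m; lra.
have Hc : half_covered A B (fun j => y j.1 j.2) r.
  move=> n; apply: (@le_trans _ _ (\sum_(m < n) (\prod_(i < N) \prod_(k < 2) (b m i k - a m i k)
      + e / 2 ^+ m.+1))).
    apply: ler_sum => m _; rewrite pair_big/=; have [_] := Htt m; apply: le_trans.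
    apply: ler_prod => j _; rewrite overlap_ge0/=.
    by apply: (le_trans (overlap_le _ _ (AB m j))); rewrite /A /B; lra.
  rewrite big_split/=.
  by have := sumab n; have := sum_geometric_half_le n (ltW e0); rewrite /e; lra.
have [x [xy Hx]] := nested_boxes AB r0 Hc.
exists (fun i k => x (i, k)); split; last first.
  by move=> i k; have := xy (i, k) => /= /andP[? ?]; rewrite ler_norml; apply/andP; lra.
move=> /Lab [m _ /= xm].
have [tm _] := Htt m.
have [n Hn] : exists n, r / 2 ^+ n < t m / 2.
  have : 0 < t m / 2 / r by rewrite !divr_gt0.
  move=> h; near \oo => n; exists n.
  rewrite -[ltRHS](@divfK _ r) ?gt_eqF// mulrC ltr_pM2r// -div1r.
  by near: n; exact: near_infty_natSinv_expn_lt (PosNum h).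
have [l [Hl lx]] := Hx n.
have := Hl m.+1; rewrite leNgt => /negP; apply.
rewrite big_ord_recr/=.
have -> : \prod_(j : J) overlap (A m j) (B m j) (l j) (l j + r / 2 ^+ n) = (r / 2 ^+ n) ^+ #|J|.
  rewrite -prodr_const; apply: eq_bigr => j _.
  have /andP[? ?] := lx j; have := xm j.1 j.2; rewrite -surjective_pairing => /andP[? ?].
  have : 0 < r / 2 ^+ n by rewrite divr_gt0// exprn_gt0.
  by move=> ?; rewrite overlap_sub /A /B; lra.
have : 0 < (r / 2 ^+ n) ^+ #|J| by rewrite exprn_gt0// divr_gt0// exprn_gt0.
have : 0 <= \sum_(m0 < m) \prod_j overlap (A m0 j) (B m0 j) (l j) (l j + r / 2 ^+ n).
  by apply: sumr_ge0 => k _; apply: prodr_ge0 => j _; exact: overlap_ge0.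
by lra.
Unshelve. all: by end_near. Qed.

End null_sets.

(** * Generic configurations *)

Section generic_configurations.
Context {R : realType}.
Variable N : nat.
Implicit Types (x y : config R N).

Definition generic x := ~ degenerate x /\ ~ switching x.

Lemma poly_small_nonroot (p : {poly R}) (r : R) : p != 0 -> 0 < r ->
  exists2 s, 0 < s <= r & p.[s] != 0.
Proof.
move=> p0 r0; apply: contrapT => H.
pose rs := [seq r / k.+1%:R | k <- iota 0 (size p)].
have : (size rs < size p)%N.
  apply: max_poly_roots => //.
    apply/allP => s /mapP[k _ ->]; apply/rootP/eqP; apply: contrapT => /negP ps.
    apply: H; exists (r / k.+1%:R) => //; rewrite divr_gt0//=.
    by rewrite ler_pdivrMr// ler_peMr ?ler1n// ltW.
  rewrite map_inj_uniq ?iota_uniq// => k l /(mulfI (lt0r_neq0 r0)) /invr_inj /eqP.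
  by rewrite eqr_nat eqSS => /eqP.
by rewrite size_map size_iota ltnn.
Qed.

(* This makes the configuration of the points (3 ^ i, 0) generic: the quadratic
   polynomials that express degeneracy of y + s u then have a nonzero leading
   coefficient. *)
Lemma pow3_avg (i j k : nat) : j <> k -> j <> i -> k <> i ->
  (2 * 3 ^ i <> 3 ^ j + 3 ^ k)%N.
Proof.
move=> jk ji ki.
have lt3 m n : (m < n)%N -> (3 * 3 ^ m <= 3 ^ n)%N by move=> mn; rewrite -expnS leq_exp2l.
have := expn_gt0 3 i; have := expn_gt0 3 j; have := expn_gt0 3 k; rewrite !orTb => k0 j0 i0.
have [ij|ij] := ltnP i j; first by have := lt3 _ _ ij; lia.
have [ik|ik] := ltnP i k; first by have := lt3 _ _ ik; lia.
have : (j < i)%N by lia.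
have : (k < i)%N by lia.
by move=> /lt3 + /lt3; lia.
Qed.

Lemma agent_distE x i j : agent_dist x i j =
  Num.sqrt ((x i ord0 - x j ord0) ^+ 2 + (x i ord_max - x j ord_max) ^+ 2).
Proof. by rewrite /agent_dist big_ord_recr big_ord1/=; do 2?congr (_ _); congr (_ + _); congr ((_ - _) ^+ 2); congr (x _ _); apply/val_inj. Qed.

Lemma generic_dense y (r : R) : 0 < r ->
  exists x, generic x /\ forall i k, `|x i k - y i k| <= r.
Proof.
move=> r0.
pose u (i : 'I_N) : R := (3 ^ i)%:R.
pose q i j : {poly R} :=
  ((y i ord0 - y j ord0) ^+ 2 + (y i ord_max - y j ord_max) ^+ 2)%:P
  + (2 * (y i ord0 - y j ord0) * (u i - u j)) *: 'X + ((u i - u j) ^+ 2) *: 'X^2.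
have q2 i j : (q i j)`_2 = (u i - u j) ^+ 2.
  by rewrite !coefD !coefZ coefC coefX coefXn/= mulr0 mulr1 !add0r.
pose xs (s : R) : config R N := fun i k => y i k + (k == ord0)%:R * (s * u i).
have qE s i j : (q i j).[s] = agent_dist (xs s) i j ^+ 2.
  rewrite agent_distE sqr_sqrtr ?addr_ge0 ?sqr_ge0//.
  by rewrite /q !hornerE /xs/=; ring.
have uij i j : i != j -> u i != u j.
  move=> ij; rewrite /u eqr_nat; apply: contra ij => /eqP e.
  by apply/eqP/val_inj/(@expnI 3).
pose P1 := \prod_i \prod_(j | j != i) q i j.
pose P2 := \prod_i \prod_(j | j != i) \prod_(k | (k != i) && (j != k)) (q i j - q i k).
have P10 : P1 != 0.
  apply/prodf_neq0 => i _; apply/prodf_neq0 => j ji; apply/eqP => /(congr1 (fun p : {poly R} => p`_2)).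
  by rewrite q2 coef0 => /eqP; rewrite sqrf_eq0 subr_eq0 eq_sym; apply/negP/uij.
have P20 : P2 != 0.
  apply/prodf_neq0 => i _; apply/prodf_neq0 => j ji; apply/prodf_neq0 => k /andP[ki jk].
  apply/eqP => /(congr1 (fun p : {poly R} => p`_2)); rewrite coefB !q2 coef0 => /eqP.
  rewrite subr_eq0 eqf_sqr => /orP[|].
    by rewrite (inj_eq (addrI _)) eqr_opp; apply/negP/uij.
  rewrite -subr_eq0 opprK => /eqP h.
  have : (2 * 3 ^ i)%:R = (3 ^ j + 3 ^ k)%:R :> R.
    by rewrite natrM natrD -/(u i) -/(u j) -/(u k); lra.
  move=> /eqP; rewrite eqr_nat => /eqP.
  by apply: pow3_avg => /val_inj /eqP; apply/negP.
pose rr := r / (3 ^ N)%:R.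
have rr0 : 0 < rr by rewrite divr_gt0// ltr0n expn_gt0.
have [s /andP[s0 sr]] := poly_small_nonroot (mulf_neq0 P10 P20) rr0.
rewrite hornerM mulf_eq0 negb_or => /andP[h1 h2].
exists (xs s); split; last first.
  move=> i k; rewrite /xs addrAC subrr add0r normrM normr_nat.
  apply: (@le_trans _ _ (1 * (s * u i))).
    by rewrite ger0_norm ?mulr_ge0 ?(ltW s0)// ler_wpM2r ?mulr_ge0 ?(ltW s0)// lern1 leq_b1.
  rewrite mul1r; apply: (@le_trans _ _ (rr * (3 ^ N)%:R)).
    by rewrite ler_pM// ?(ltW s0)// ler_nat leq_exp2l// ltnW.
  by rewrite /rr divfK// pnatr_eq0 -lt0n expn_gt0.
split.
- move=> [i [j [ij e]]]; move: h1; rewrite horner_prod => /prodf_neq0 /(_ i isT).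
  rewrite horner_prod => /prodf_neq0 /(_ j); rewrite eq_sym ij => /(_ isT).
  rewrite qE agent_distE !e !subrr expr0n/= addr0 sqrtr0 expr0n/=.
  by rewrite eqxx.
- move=> [i [j [k [jk ji ki e]]]]; move: h2; rewrite horner_prod => /prodf_neq0 /(_ i isT).
  rewrite horner_prod => /prodf_neq0 /(_ j ji); rewrite horner_prod => /prodf_neq0 /(_ k).
  by rewrite jk ki => /(_ isT); rewrite hornerD hornerN !qE e subrr eqxx.
Qed.

Lemma agent_dist_ge0 x i j : 0 <= agent_dist x i j.
Proof. exact: sqrtr_ge0. Qed.

Lemma generic_closest x : (2 <= N)%N -> generic x ->
  exists c : 'I_N -> 'I_N, forall i, is_closest x i (c i).
Proof.
move=> N2 [nd ns]; suff H : forall i, exists j, is_closest x i j by have [c Hc] := choice H; exists c.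
move=> i.
have [j0 j0i] : exists j0 : 'I_N, j0 != i.
  case: N N2 i {x nd ns} => [//|[//|n]] _ i.
  by have [->|] := eqVneq i ord0; [exists ord_max|exists ord0; rewrite eq_sym].
pose j := [arg min_(j < j0 | j != i) agent_dist x i j]%O.
exists j; rewrite /j; case: arg_minP => // {}j ji jmin; split=> // l li lj.
rewrite lt_neqAle jmin// andbT; apply/eqP => e; apply: ns.
by exists i, j, l; split=> //; rewrite eq_sym.
Qed.

End generic_configurations.

(** * Almost everywhere differentiability of Lipschitz functions *)

Section lipschitz_ae_derivable.
Context {R : realType}.
Local Notation mu := (@lebesgue_measure R).

Lemma lipschitz_continuous (g : R -> R) (C : R) :
  0 < C -> (forall s t, `|g s - g t| <= C * `|s - t|) -> continuous g.
Proof.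
move=> C0 gC x; apply/cvgrPdist_le => e e0; near=> y.
apply: (le_trans (gC _ _)); rewrite mulrC -ler_pdivlMr//.
near: y; apply: cvgr_dist_le; [exact: cvg_id|exact: divr_gt0].
Unshelve. all: by end_near. Qed.

Lemma stieltjes_ocitvE (f : cumulative R R) (X : set R) : ocitv X ->
  lebesgue_stieltjes_measure f X = wlength f X.
Proof. by move=> oX; rewrite /= /lebesgue_stieltjes_measure/= /measure_extension measurable_mu_extE. Qed.

Section dominated.
Variables (F G : cumulative R R) (c : R).
Hypotheses (c0 : 0 < c) (FG : forall x, F x + G x = c * x).

Lemma lebesgue_measure_stieltjesD (A : set (measurableTypeR R)) : measurable A ->
  mu A = (c^-1%:E * (lebesgue_stieltjes_measure F A + lebesgue_stieltjes_measure G A))%E.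
Proof.
have ci0 : 0 <= c^-1 by rewrite invr_ge0 ltW.
pose m := mscale (NngNum ci0)
  (measure_add (lebesgue_stieltjes_measure F) (lebesgue_stieltjes_measure G)).
move=> mA.
rewrite (@lebesgue_measure_unique _ m) //; first by rewrite -measure_addE.
move=> X oX; transitivity ((c^-1)%:E * (lebesgue_stieltjes_measure F X + lebesgue_stieltjes_measure G X))%E; last by rewrite -measure_addE.
rewrite !stieltjes_ocitvE//.
rewrite /lebesgue_measure stieltjes_ocitvE//.
case/ocitvP : oX => [->|[[a b] /= ab ->]]; first by rewrite !wlength0 adde0 mule0.
rewrite !wlength_itv_bnd ?(ltW ab)// -EFinD -EFinM; congr EFin.
have -> : F b - F a + (G b - G a) = (F b + G b) - (F a + G a) by ring.
by rewrite !FG -mulrBr mulrA mulVf ?gt_eqF// mul1r.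
Qed.

Lemma stieltjes_null (A : set (measurableTypeR R)) : measurable A -> mu A = 0%E ->
  lebesgue_stieltjes_measure F A = 0%E.
Proof.
move=> mA; rewrite lebesgue_measure_stieltjesD// => /eqP.
rewrite mule_eq0 eqe invr_eq0 gt_eqF//= padde_eq0// ?measure_ge0//.
by case/andP => /eqP.
Qed.

End dominated.


Lemma lipschitz_ae_derivable (g : R -> R) (C T : R) :
  0 < C -> (forall s t, `|g s - g t| <= C * `|s - t|) -> 
  {ae mu, forall t, 0 < t < T -> derivable g t 1}.
Proof.
move=> C0 gC.
have cg := lipschitz_continuous C0 gC.
pose F s := g s + C * s; pose G s := C * s - g s.
have cC : continuous (fun s : R => C * s) by move=> x; apply: cvgM; [exact: cvg_cst|exact: cvg_id].
have cF : continuous F by move=> x; apply: cvgD; [exact: cg|exact: cC].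
have cG : continuous G by move=> x; apply: cvgB; [exact: cC|exact: cg].
have gCle s t : s <= t -> `|g s - g t| <= C * (t - s).
  by move=> st; have := gC s t; rewrite (distrC s) (ger0_norm (_ : 0 <= t - s)) ?subr_ge0.
have ndF : {homo F : x y / x <= y}.
  by move=> x y xy; have := gCle x y xy; rewrite /F ler_norml => /andP[]; lra.
have ndG : {homo G : x y / x <= y}.
  by move=> x y xy; have := gCle x y xy; rewrite /G ler_norml => /andP[]; lra.
have iF := isCumulative.Build R _ R F ndF (right_continuousW cF).
have iG := isCumulative.Build R _ R G ndG (right_continuousW cG).
pose F' : cumulative R R := HB.pack F iF.
pose G' : cumulative R R := HB.pack G iG.
pose D : set (measurableTypeR R) := `]0, T]%classic.
have mD : measurable D by exact: measurable_itv.
have [T0|T0] := ltP 0 T; last first.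
  by apply/aeW => t /andP[t0 tT]; move: (lt_trans t0 tT); rewrite ltNge T0.
have Foc a b : a <= b -> lebesgue_stieltjes_measure F' `]a, b]%classic = (F b - F a)%:E.
  by move=> ab; rewrite stieltjes_ocitvE// ?wlength_itv_bnd//; exact: is_ocitv.
have Doo : (lebesgue_stieltjes_measure F' D < +oo)%E by rewrite Foc ?ltW// ltry.
pose nu := mfrestr mD Doo.
have numu : nu `<< mu.
  apply/null_content_dominatesP.
  move=> A mA muA0; rewrite /nu /mfrestr /mrestr/=.
  apply: (@stieltjes_null F' G' (2 * C)) => //=.
  - by rewrite mulr_gt0.
  - by move=> x; rewrite /F /G; ring.
  - exact: measurableI.
  - by apply: (subset_measure0 _ _ _ muA0) => //; exact: measurableI.
pose f := fine \o Radon_Nikodym_SigmaFinite.f nu mu.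
have fE : EFin \o f = Radon_Nikodym_SigmaFinite.f nu mu.
  by apply/funext => x /=; rewrite fineK//; exact: Radon_Nikodym_SigmaFinite.f_fin_num.
have fint : mu.-integrable setT (EFin \o f).
  by rewrite fE; exact: Radon_Nikodym_SigmaFinite.f_integrable.
have floc : locally_integrable setT f.
  by apply: open_integrable_locally => //; exact: openT.
have finty y : mu.-integrable [set` Interval (BRight 0) (BRight y)] (EFin \o f).
  by apply: (integrableS measurableT).
have := FTC1 finty floc.
apply: filterS; first exact: (ae_filter_ringOfSetsType mu).
move=> t /= + /andP[t0 tT].
have bt : (BRight 0 < BRight t)%O by rewrite bnd_simp.
move=> /(_ bt) [dF _].
have FE : \forall y \near t, (\int[mu]_(x in `]0%R, y]) f x)%R = F y - F 0.
  near=> y.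
  have y0 : 0 < y by near: y; exact: lt_nbhsr.
  have yT : y < T by near: y; exact: lt_nbhsl.
  apply: EFin_inj; rewrite /Rintegral.
  have my : measurable (`]0, y]%classic : set (measurableTypeR R)) by exact: measurable_itv.
  have <- : nu `]0, y]%classic = (F y - F 0)%:E.
    rewrite /nu /mfrestr /mrestr setIidl ?Foc ?ltW//.
    move=> z; rewrite /D /= !in_itv/= => /andP[-> zy] /=.
    exact: le_trans zy (ltW yT).
  apply/esym/(etrans (Radon_Nikodym_SigmaFinite.f_integral numu my)).
  rewrite -fE fineK//.
  exact: integrable_fin_num.
have dF' : derivable (fun y => F y - F 0) t 1.
  exact: near_eq_derivable FE dF.
have -> : g = (fun y => F y - F 0) + (fun y => F 0 - C * y).
  by apply/funext => y; rewrite /F fctE; ring.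
exact: derivableD.
Unshelve. all: by end_near. Qed.
End lipschitz_ae_derivable.

Lemma bernoulli_le (R : realFieldType) (x : R) n : 0 <= x -> 1 + n%:R * x <= (1 + x) ^+ n.
Proof.
move=> x0; elim: n => [|n IH]; first by rewrite mul0r addr0 expr0.
rewrite exprS; apply: (@le_trans _ _ ((1 + x) * (1 + n%:R * x))).
  have : 0 <= n%:R * x * x by rewrite !mulr_ge0.
  by rewrite -natr1; lra.
by rewrite ler_wpM2l//; lra.
Qed.

Lemma exp_dominates_poly (R : realType) (eta : R) (C D : nat) : 0 < eta ->
  exists K : nat, ((C * K.+1) ^ D)%:R < (1 + eta) ^+ K.
Proof.
move=> eta0.
pose A : R := (C * D.+2)%:R ^+ D / eta ^+ D.+1 + 1.
pose j := (Num.truncn A).+1.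
have jA : A < j%:R by exact: truncnS_gt.
exists (j * D.+1)%N.
rewrite exprM; apply: (@lt_le_trans _ _ ((j%:R * eta) ^+ D.+1)); last first.
  have e1 : 0 <= eta by exact: ltW.
  rewrite lerXn2r ?nnegrE ?mulr_ge0 ?exprn_ge0 ?addr_ge0//.
  by apply: le_trans (bernoulli_le _ e1); lra.
apply: (@le_lt_trans _ _ ((C * D.+2 * j)%:R ^+ D)).
  rewrite natrX lerXn2r ?nnegrE// ler_nat -mulnA leq_mul2l; apply/orP; right.
  by rewrite -addn1 [leqRHS]mulnC [in leqRHS]mulnS addnC leq_add.
rewrite [_%:R]natrM exprMn mulrC.
rewrite [ltRHS](_ : _ = j%:R ^+ D * (j%:R * eta ^+ D.+1)); last by rewrite exprMn exprS; ring.
rewrite ltr_pM2l ?exprn_gt0 ?ltr0n//.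
by rewrite -ltr_pdivrMr ?exprn_gt0//; apply: lt_trans jA; rewrite /A ltrDl.
Qed.

(** * Averaging over a lattice of perturbations *)

Section perturbation_lattice.
Context {R : realType}.
Variables (N : nat) (a p D0 : 'I_N -> 'I_N -> R) (P : pred 'I_N) (jj : 'I_N -> 'I_N).
Variables (k1 : R) (Q W : nat).
Hypothesis jjP : forall i, jj i != i.
Hypothesis a_le1 : forall i j, `|a i j| <= 1.
Hypothesis p_ge0 : forall i j, 0 <= p i j.
Hypothesis p_sym : forall i j, p i j = p j i.
Hypothesis p_sum : \sum_i \sum_(j | j != i) p i j = 1.
Hypothesis D0_ge0 : forall i j, 0 <= D0 i j.
Hypothesis D0_sym : forall i j, D0 i j = D0 j i.
Hypothesis D0_sum : \sum_i \sum_(j | j != i) p i j * D0 i j <= 1.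
Let s i := \sum_(j | j != i) p i j * a i j.
Hypothesis s_ge0 : forall i, 0 <= s i.
Hypothesis k1_gt0 : 0 < k1.
Hypothesis p_big : forall i, P i -> exists2 j, j != i & k1 <= p i j.

Let T := ({ffun 'I_N -> 'I_(2 * Q).+1} * 'I_W.+1)%type.
Implicit Types (g : T) (i j k : 'I_N).

(* A lattice point g stands for the displacement offset g i of agent i along w_i,
   together with a common shift g.2 of all the gaps.  The cyclic
   wrap-around in both coordinates is harmless, since the admissible points stay
   away from it. *)
Definition offset (g : T) i : R := (g.1 i)%:R - Q%:R.
Definition gap (g : T) i j : R :=
  D0 i j + g.2%:R + offset g i * a i j + offset g j * a j i.
Definition mass (g : T) : R :=
  \sum_i \sum_(j | j != i) p i j * D0 i j + g.2%:R + 2 * \sum_i offset g i * s i.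
Definition admissible r l : pred T := fun g =>
  [&& [forall i, `|offset g i| <= r%:R],
      [forall i, forall j, (j != i) ==> (0 <= gap g i j)] & mass g <= l%:R].
Definition thin (g : T) := [exists i, exists j, (j != i) && (gap g i j < 1)].
Definition nearest (g : T) i := [arg min_(j < jj i | j != i) gap g i j]%O.
Definition min_gap (g : T) i := gap g i (nearest g i).
Definition shift i (g : T) : T :=
  ([ffun j => if j == i then ordS (g.1 j) else g.1 j], g.2).
Definition raise (g : T) : T := (g.1, ordS g.2).

Lemma s_le1 i : s i <= 1.
Proof.
apply: (@le_trans _ _ (\sum_(j | j != i) p i j)).
  apply: ler_sum => j _; rewrite ler_piMr//.
  by have := a_le1 i j; rewrite ler_norml => /andP[].
rewrite -[leRHS]p_sum [leRHS](bigD1 i)//= lerDl.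
by apply: sumr_ge0 => k _; exact: sumr_ge0.
Qed.

Lemma gap_sym g i j : gap g i j = gap g j i.
Proof. by rewrite /gap D0_sym; ring. Qed.

Lemma nearestP g i : nearest g i != i /\ forall j, j != i -> min_gap g i <= gap g i j.
Proof. by rewrite /min_gap /nearest; case: arg_minP => //; exact: jjP. Qed.

Lemma admissibleP r l g : reflect
  [/\ forall i, `|offset g i| <= r%:R, forall i j, j != i -> 0 <= gap g i j &
      mass g <= l%:R] (admissible r l g).
Proof.
apply: (iffP and3P) => [[/forallP h1 /forallP h2 h3]|[h1 h2 h3]]; split=> //.
- by move=> i j; move/forallP : (h2 i) => /(_ j) /implyP.
- exact/forallP.
- by apply/forallP => i; apply/forallP => j; apply/implyP; exact: h2.
Qed.

Lemma massE g : mass g = \sum_i \sum_(j | j != i) p i j * gap g i j.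
Proof.
rewrite /mass /gap.
have -> : \sum_i \sum_(j | j != i) p i j * (D0 i j + g.2%:R + offset g i * a i j + offset g j * a j i)
  = \sum_i \sum_(j | j != i) p i j * D0 i j + (\sum_i \sum_(j | j != i) p i j) * g.2%:R
   + \sum_i offset g i * s i + \sum_i \sum_(j | j != i) p i j * (offset g j * a j i).
  rewrite mulr_suml -!big_split/=; apply: eq_bigr => i _.
  rewrite mulr_suml /s mulr_sumr -!big_split/=; apply: eq_bigr => j _; ring.
have -> : \sum_i \sum_(j | j != i) p i j * (offset g j * a j i) = \sum_i offset g i * s i.
  rewrite (exchange_big_dep predT)//=; apply: eq_bigr => i _.
  rewrite /s mulr_sumr; apply: eq_big => [j|j _]; first by rewrite eq_sym.
  by rewrite p_sym; ring.
by rewrite p_sum; ring.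
Qed.

Lemma shift_inj i : injective (shift i).
Proof.
move=> [f m] [f' m'] e; have /ffunP ff' := congr1 fst e; have /= mm' := congr1 snd e.
congr pair => //; apply/ffunP => j; have := ff' j; rewrite !ffunE; case: eqP => // _.
exact: ordS_inj.
Qed.

Lemma raise_inj : injective raise.
Proof.
move=> [f m] [f' m'] e; have /= ff' := congr1 fst e; have /= mm' := congr1 snd e.
by congr pair => //; exact: ordS_inj.
Qed.

Lemma offset_shift i g j : (g.1 i < 2 * Q)%N ->
  offset (shift i g) j = offset g j + (j == i)%:R.
Proof.
move=> h; rewrite /offset /shift/= ffunE; case: eqP => [->|_]/=; last by rewrite addr0.
by rewrite modn_small ?ltnS// -natr1; ring.
Qed.

Lemma gap_shift i g j k : k != j -> (g.1 i < 2 * Q)%N ->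
  gap (shift i g) j k = gap g j k + (j == i)%:R * a i k + (k == i)%:R * a i j.
Proof.
move=> kj h; rewrite /gap !offset_shift//=.
have [->|_] := eqVneq j i; have [->|_] := eqVneq k i; rewrite /=; ring.
Qed.

Lemma mass_shift i g : (g.1 i < 2 * Q)%N -> mass (shift i g) = mass g + 2 * s i.
Proof.
move=> h; rewrite /mass/=.
have -> : \sum_j offset (shift i g) j * s j = \sum_j offset g j * s j + s i.
  under eq_bigr do rewrite offset_shift// mulrDl.
  rewrite big_split/=; congr (_ + _); rewrite (bigD1 i)//= eqxx mul1r big1 ?addr0//.
  by move=> j /negbTE ->; rewrite mul0r.
ring.
Qed.

Lemma admissible_lt r l g i : (r < Q)%N -> admissible r l g -> (g.1 i < 2 * Q)%N.
Proof.
move=> rQ /admissibleP[/(_ i) + _ _]; rewrite /offset ler_norml => /andP[_ h].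
rewrite -(ltr_nat R) natrM; move: rQ; rewrite -(ltr_nat R); lra.
Qed.

Lemma min_gap_le r l g i : P i -> admissible r l g -> min_gap g i <= l%:R / k1.
Proof.
move=> Pi /admissibleP[_ h0 ml]; have [j ji pj] := p_big Pi.
have [_ /(_ j ji) h] := nearestP g i; apply: (le_trans h).
rewrite ler_pdivlMr// mulrC; apply: (@le_trans _ _ (p i j * gap g i j)).
  by rewrite ler_wpM2r// h0.
apply: le_trans ml; rewrite massE (bigD1 i)//= (bigD1 j)//= -addrA lerDl addr_ge0//.
  by apply: sumr_ge0 => k /andP[ki _]; rewrite mulr_ge0// h0.
by apply: sumr_ge0 => k _; apply: sumr_ge0 => k' kk; rewrite mulr_ge0// h0.
Qed.

Lemma min_gap_shift_le r l g i c err : (r < Q)%N -> admissible r l g -> c != i ->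
  (forall j, j != i -> gap g i c <= gap g i j + err) ->
  min_gap (shift i g) i - min_gap g i <= a i c + err.
Proof.
move=> rQ Ag ci h; have [ni _] := nearestP g i; have := h _ ni.
have [_ /(_ c ci)] := nearestP (shift i g) i.
rewrite gap_shift ?(admissible_lt i rQ Ag)// eqxx (negbTE ci) mul1r mul0r addr0.
by rewrite /min_gap; lra.
Qed.

Lemma min_gap_shift_ge r l g i : (r < Q)%N -> admissible r l g ->
  - (thin g)%:R <= min_gap (shift i g) i.
Proof.
move=> rQ Ag; have [ni _] := nearestP (shift i g) i; rewrite /min_gap.
rewrite gap_shift ?(admissible_lt i rQ Ag)// eqxx (negbTE ni) mul1r mul0r addr0.
set j := nearest _ _ in ni *.
have := a_le1 i j; rewrite ler_norml => /andP[aj _].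
have /admissibleP[_ /(_ i j ni) gj _] := Ag.
have [tg|ng] := boolP (thin g) => /=; first lra.
suff : 1 <= gap g i j by rewrite oppr0; lra.
rewrite leNgt; apply: contra ng => gj1; apply/existsP; exists i.
by apply/existsP; exists j; rewrite ni.
Qed.

Lemma min_gap_entry r l g i : P i -> (r < Q)%N -> admissible r l (shift i g) ->
  ~~ admissible r l g ->
  min_gap (shift i g) i <= (thin (shift i g))%:R +
    (offset (shift i g) i == - r%:R)%:R * (l%:R / k1).
Proof.
move=> Pi rQ Ag nAg.
have lk : 0 <= l%:R / k1 :> R by rewrite divr_ge0// ltW.
have [_|offr] := eqVneq; first by rewrite mul1r (le_trans (min_gap_le Pi Ag))// lerDr.
rewrite mul0r addr0.
have /admissibleP[A1 A2 A3] := Ag.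
have gi : (g.1 i < 2 * Q)%N.
  rewrite ltn_neqAle -ltnS ltn_ord andbT; apply/eqP => gi.
  have := A1 i; rewrite /offset /shift/= ffunE eqxx/= gi modnn sub0r normrN normr_nat ler_nat.
  by rewrite leqNgt rQ.
have off j := offset_shift j gi.
have offi : offset g i = offset (shift i g) i - 1 by rewrite off eqxx /=; ring.
have A1' j : `|offset g j| <= r%:R.
  have [->|ji] := eqVneq j i; last by have := A1 j; rewrite off (negbTE ji) addr0.
  have := A1 i; rewrite !ler_norml offi => /andP[h1 h2]; apply/andP; split; last lra.
  have : - r%:R < offset (shift i g) i by rewrite lt_neqAle eq_sym offr h1.
  rewrite off eqxx /offset /= => h3; have : (Q < (g.1 i).+1 + r)%N.
    by rewrite -(ltr_nat R) natrD -natr1; lra.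
  by rewrite addSn ltnS -(ler_nat R) natrD; lra.
have A3' : mass g <= l%:R by move: A3; rewrite mass_shift//; have := s_ge0 i; lra.
have [j [k [kj gjk]]] : exists j k, k != j /\ gap g j k < 0.
  apply: contrapT => H; move/negP : nAg; apply; apply/admissibleP; split=> // j k kj.
  by rewrite leNgt; apply/negP => gjk; apply: H; exists j, k.
have [k' k'i gk'] : exists2 k', k' != i & gap (shift i g) i k' < 1.
  have gs := gap_shift kj gi; have := A2 j k kj.
  have [ji|ji] := eqVneq j i.
    subst j; move: gs; rewrite eqxx (negbTE kj) mul1r mul0r addr0 => gs gek; exists k => //.
    by rewrite gs; have := a_le1 i k; rewrite ler_norml => /andP[_]; lra.
  move: gs; rewrite (negbTE ji) mul0r ?addr0; have [ki|ki] := eqVneq k i.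
    subst k; rewrite mul1r => gs gek; exists j => //; rewrite gap_sym gs.
    by have := a_le1 i j; rewrite ler_norml => /andP[_]; lra.
  by rewrite mul0r addr0 => -> ; rewrite leNgt gjk.
have -> : thin (shift i g).
  by apply/existsP; exists i; apply/existsP; exists k'; rewrite k'i.
by have [_ /(_ _ k'i)] := nearestP (shift i g) i; rewrite /=; lra.
Qed.

Let X r l := #|admissible r l|.

(* Summation by parts along the lines in direction i: a line enters the admissible
   set either where min_gap is at most 1 or through the face offset g i = - r of
   the box. *)
Lemma sum_min_gap_shift r l i : P i -> (r < Q)%N ->
  - (2 * #|[pred g | admissible r l g & thin g]|%:R
     + #|[pred g | admissible r l g & offset g i == - r%:R]|%:R * (l%:R / k1))
  <= \sum_(g | admissible r l g) (min_gap (shift i g) i - min_gap g i).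
Proof.
move=> Pi rQ; rewrite sumrB.
pose S := \sum_(g | admissible r l g && admissible r l (shift i g)) min_gap (shift i g) i.
have natsum (B : pred T) (f : T -> bool) :
   #|[pred g | B g & f g]|%:R = \sum_(g | B g) (f g)%:R :> R.
  rewrite -sum1_card natr_sum [LHS](big_mkcond)/= [RHS]big_mkcond/=.
  by apply: eq_bigr => g _; rewrite inE; case: (B g); case: (f g).
have H1 : S - \sum_(g | admissible r l g) (thin g)%:R <=
    \sum_(g | admissible r l g) min_gap (shift i g) i.
  rewrite [leRHS](bigID (fun g => admissible r l (shift i g)))/= lerD2l.
  rewrite -sumrN; apply: (@le_trans _ _
     (\sum_(g | admissible r l g && ~~ admissible r l (shift i g)) - (thin g)%:R)).
    rewrite [leLHS](bigID (fun g => admissible r l (shift i g)))/= gerDr.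
    by apply: sumr_le0 => g _; rewrite oppr_le0.
  by apply: ler_sum => g /andP[Ag _]; exact: min_gap_shift_ge Ag.
have H2 : \sum_(g | admissible r l g) min_gap g i <= S + \sum_(g | admissible r l g)
    ((thin g)%:R + (offset g i == - r%:R)%:R * (l%:R / k1)).
  have lk : 0 <= l%:R / k1 :> R by rewrite divr_ge0// ltW.
  rewrite (reindex_inj (@shift_inj i)) (bigID (admissible r l))/= lerD//.
    by rewrite /S; under eq_bigl do rewrite andbC.
  rewrite [leRHS](reindex_inj (@shift_inj i)) [leRHS](bigID (admissible r l))/=.
  rewrite -[leLHS]add0r lerD//.
    by apply: sumr_ge0 => g _; rewrite addr_ge0// mulr_ge0.
  by apply: ler_sum => g /andP[Ag nAg]; exact: min_gap_entry.
have E : \sum_(g | admissible r l g) ((thin g)%:R + (offset g i == - r%:R)%:R * (l%:R / k1)) =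
    #|[pred g | admissible r l g & thin g]|%:R
    + #|[pred g | admissible r l g & offset g i == - r%:R]|%:R * (l%:R / k1).
  by rewrite big_split/= -mulr_suml -!natsum.
move: H2; rewrite E => H2.
by move: H1; rewrite -natsum; lra.
Qed.

Lemma admissible_mono r r' l l' g : (r <= r')%N -> (l <= l')%N ->
  admissible r l g -> admissible r' l' g.
Proof.
move=> rr' ll' /admissibleP[h1 h2 h3]; apply/admissibleP; split=> //.
  by move=> i; rewrite (le_trans (h1 i))// ler_nat.
by rewrite (le_trans h3)// ler_nat.
Qed.

Lemma card_admissible_mono r r' l l' : (r <= r')%N -> (l <= l')%N -> (X r l <= X r' l')%N.
Proof.
move=> rr' ll'; rewrite /X; apply: subset_leq_card; apply/fintype.subsetP => g.
exact: admissible_mono.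
Qed.

Lemma card_thin r l : (l + 2 * N * r < W)%N ->
  (#|[pred g | admissible r l.+1 g & thin g]| + X r l <= X r l.+1)%N.
Proof.
move=> lW.
rewrite -[X r l.+1](cardID thin) leq_add//.
rewrite /X -(card_imset _ raise_inj); apply: subset_leq_card; apply/fintype.subsetP => _ /imsetP[g Ag ->].
have /admissibleP[A1 A2 A3] : admissible r l g by [].
have gW : (g.2 < W)%N.
  apply: leq_ltn_trans lW; rewrite -(ler_nat R) natrD.
  have : 0 <= \sum_i \sum_(j | j != i) p i j * D0 i j.
    by apply: sumr_ge0 => i _; apply: sumr_ge0 => j _; rewrite mulr_ge0.
  have : - (N * r)%:R <= \sum_i offset g i * s i.
    have -> : - (N * r)%:R = \sum_(i < N) - r%:R :> R.
      by rewrite sumr_const card_ord mulNrn natrM mulr_natl.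
    apply: ler_sum => i _; have := A1 i; rewrite ler_norml => /andP[h _].
    apply: (@le_trans _ _ (- r%:R * s i)); last by rewrite ler_wpM2r.
    by rewrite mulNr lerN2 ler_piMr// s_le1.
  by move: A3; rewrite /mass -mulnA [in X in _ -> _ -> _ -> X]natrM; lra.
have g2 : (raise g).2%:R = g.2%:R + 1 :> R.
  by rewrite /raise/= modn_small ?ltnS// -natr1.
have gapE i j : gap (raise g) i j = gap g i j + 1.
  by rewrite /gap g2 /offset/=; ring.
rewrite !inE; apply/andP; split.
  apply/negP => /existsP[i /existsP[j /andP[ji]]]; rewrite gapE.
  by have := A2 i j ji; lra.
apply/admissibleP; split=> //.
  by move=> i j ji; rewrite gapE; have := A2 i j ji; lra.
by rewrite /mass g2 -natr1; move: A3; rewrite /mass /offset/=; lra.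
Qed.

Lemma card_outer r l i :
  (#|[pred g | admissible r.+1 l g & offset g i == - r.+1%:R]| + X r l <= X r.+1 l)%N.
Proof.
rewrite -[X r.+1 l](cardID [pred g | offset g i == - r.+1%:R]) leq_add//.
apply: subset_leq_card; apply/fintype.subsetP => g Ag; rewrite !inE; apply/andP; split; last first.
  exact: admissible_mono Ag.
have /admissibleP[/(_ i) + _ _] : admissible r l g by [].
apply: contraTneq => ->; rewrite normrN normr_nat -ltNge ltr_nat.
exact: ltnSn.
Qed.

Lemma card_admissible0 : (0 < X 0 1)%N.
Proof.
have Q1 : (Q < (2 * Q).+1)%N by rewrite ltnS leq_pmull.
apply/card_gt0P; exists ([ffun=> Ordinal Q1], ord0); apply/admissibleP.
have off i : offset ([ffun=> Ordinal Q1], ord0 : 'I_W.+1) i = 0.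
  by rewrite /offset ffunE/= subrr.
split.
- by move=> i; rewrite off normr0.
- by move=> i j _; rewrite /gap !off !mul0r !addr0.
- by rewrite /mass [X in 2 * X]big1 ?mulr0 ?addr0// => i _; rewrite off mul0r.
Qed.

(* The numbers X (k ^ 2) k.+1 cannot all grow by a factor 1 + eta, as they are
   bounded polynomially in k; at a step where they do not, thin points and the
   outer face are negligible.  The box grows quadratically because the loss on
   the outer face is multiplied by the bound l / k1 on min_gap. *)
Lemma average_min_gap_shift (K : nat) (eta : R) : 0 < eta -> Q = (K ^ 2).+1 ->
  W = ((2 * N + 2) * K.+1 ^ 2)%N -> #|{: T}|%:R < (1 + eta) ^+ K ->
  exists r l g, [/\ (r < Q)%N, admissible r l g &
   - (N%:R * (2 + 2 / k1) * eta) <=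
     \sum_(i | P i) (min_gap (shift i g) i - min_gap g i)].
Proof.
move=> eta0 QE WE cardT.
have [k kK Hk] : exists2 k, (k < K)%N &
    (X (k.+1 ^ 2) k.+2)%:R <= (1 + eta) * (X (k ^ 2) k.+1)%:R :> R.
  apply: contrapT => H; have : (1 + eta) ^+ K <= (X (K ^ 2) K.+1)%:R.
    have : (K <= K)%N by []; elim: {-2}K => [_|k IH kK].
      by rewrite expr0 ler1n; exact: card_admissible0.
    rewrite exprS; apply: (@le_trans _ _ ((1 + eta) * (X (k ^ 2) k.+1)%:R)).
      by rewrite ler_wpM2l ?IH// ?(ltnW kK)// addr_ge0// ltW.
    by rewrite leNgt; apply/negP => /ltW h; apply: H; exists k.
  by apply/negP; rewrite -ltNge; apply: le_lt_trans cardT; rewrite ler_nat max_card.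
pose x := (X (k ^ 2) k.+1)%:R : R.
have x0 : 0 < x.
  by rewrite ltr0n (leq_trans card_admissible0)// card_admissible_mono.
have kk : (k.+1 ^ 2 = k ^ 2 + (2 * k).+1)%N by rewrite !expnS expn0; ring.
have [r [kr rk Hr]] : exists r, [/\ (k ^ 2 <= r)%N, (r < k.+1 ^ 2)%N &
    (2 * k).+1%:R * ((X r.+1 k.+2)%:R - (X r k.+2)%:R) <= eta * x :> R].
  apply: contrapT => H.
  have : eta * x < (X (k.+1 ^ 2) k.+2)%:R - (X (k ^ 2) k.+2)%:R.
    rewrite -(telescope_sumr (fun r => (X r k.+2)%:R)); last by rewrite kk leq_addr.
    rewrite -(ltr_pM2l (x := (2 * k).+1%:R)) ?ltr0n// mulr_sumr.
    have -> : (2 * k).+1%:R * (eta * x) = \sum_(k ^ 2 <= r < k.+1 ^ 2) eta * x.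
      by rewrite sumr_const_nat kk addKn mulr_natl.
    rewrite big_nat [ltRHS]big_nat; apply: ltr_sum.
      by apply/hasP; exists (k ^ 2)%N; rewrite ?mem_index_iota ?leqnn kk -addn1 leq_add2l.
    move=> r /andP[h1 h2]; rewrite ltNge; apply/negP => h3.
    by apply: H; exists r.
  have : (X (k ^ 2) k.+1)%:R <= (X (k ^ 2) k.+2)%:R :> R.
    by rewrite ler_nat card_admissible_mono.
  by move: Hk; rewrite -/x; lra.
have rQ : (r.+1 < Q)%N.
  by rewrite QE ltnS; apply: leq_trans rk _; rewrite leq_exp2r.
pose l := k.+2.
have Xrl : x <= (X r.+1 l)%:R by rewrite ler_nat card_admissible_mono// ltnW.
have Hthin : #|[pred g | admissible r.+1 l g & thin g]|%:R <= eta * x.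
  have /card_thin : (k.+1 + 2 * N * r.+1 < W)%N.
    have r1 : (r.+1 <= K.+1 ^ 2)%N.
      by apply: leq_trans rk _; rewrite leq_exp2r// ltnW.
    have : (k.+1 <= K.+1 ^ 2)%N by apply: (@leq_trans K.+1); [exact: ltnW|rewrite -{1}(expn1 K.+1) leq_pexp2l].
    have : (2 * N * r.+1 <= 2 * N * K.+1 ^ 2)%N by rewrite leq_mul2l r1 orbT.
    have : (0 < K.+1 ^ 2)%N by rewrite expn_gt0.
    by rewrite WE mulnDl; lia.
  rewrite -(ler_nat R) natrD.
  have : x <= (X r.+1 k.+1)%:R by rewrite ler_nat card_admissible_mono// ltnW.
  have : (X r.+1 k.+2)%:R <= (X (k.+1 ^ 2) k.+2)%:R :> R by rewrite ler_nat card_admissible_mono.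
  by move: Hk; rewrite -/x /l; lra.
have Hout i : l%:R * #|[pred g | admissible r.+1 l g & offset g i == - r.+1%:R]|%:R <= 2 * (eta * x).
  have := card_outer r l i; rewrite -(ler_nat R) natrD => h.
  apply: le_trans (_ : 2 * ((2 * k).+1%:R * ((X r.+1 k.+2)%:R - (X r k.+2)%:R)) <= _); last lra.
  rewrite mulrA; apply: ler_pM; rewrite ?ler0n//; last by move: h; rewrite -/l; lra.
  by rewrite -natrM ler_nat; rewrite /l; lia.
have Hsum : - (N%:R * (2 + 2 / k1) * eta) * (X r.+1 l)%:R <=
    \sum_(g | admissible r.+1 l g) \sum_(i | P i) (min_gap (shift i g) i - min_gap g i).
  rewrite exchange_big/=.
  apply: (@le_trans _ _ (\sum_(i | P i) - ((2 + 2 / k1) * (eta * x)))); last first.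
    apply: ler_sum => i Pi; apply: le_trans (sum_min_gap_shift l Pi rQ).
    rewrite lerN2 [leRHS]mulrDl lerD//; first by rewrite ler_wpM2l.
    have := Hout i; set c := #|_|%:R => h.
    have -> : c * (l%:R / k1) = l%:R * c / k1 by ring.
    have -> : 2 / k1 * (eta * x) = 2 * (eta * x) / k1 by ring.
    by rewrite ler_pM2r ?invr_gt0.
  rewrite sumr_const mulNrn mulNr lerN2 -[leLHS]mulr_natl.
  have : 0 <= (2 + 2 / k1) by rewrite addr_ge0// divr_ge0// ltW.
  set z := 2 + 2 / k1 => z0.
  have cP : #|P|%:R <= N%:R :> R by rewrite ler_nat -[leqRHS]card_ord max_card.
  apply: (@le_trans _ _ (N%:R * (z * (eta * x)))).
    by rewrite ler_wpM2r// !mulr_ge0// ltW.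
  by rewrite -!mulrA !ler_wpM2l// ltW.
apply: contrapT => H.
have : \sum_(g | admissible r.+1 l g) \sum_(i | P i) (min_gap (shift i g) i - min_gap g i) <
   \sum_(g | admissible r.+1 l g) - (N%:R * (2 + 2 / k1) * eta).
  apply: ltr_sum.
    have : (0 < X r.+1 l)%N by rewrite -(ltr_nat R); apply: lt_le_trans Xrl.
    by case/card_gt0P => g Ag; apply/hasP; exists g; rewrite ?mem_index_enum.
  move=> g Ag; rewrite ltNge; apply/negP => h; apply: H.
  by exists r.+1, l, g.
by rewrite sumr_const -[ltRHS]mulr_natr => /lt_le_trans /(_ Hsum); rewrite ltxx.
Qed.

End perturbation_lattice.

Lemma lattice_perturbation (R : realType) (N : nat) (kap k1 : R) :
  0 < kap -> 0 < k1 -> exists Rm : nat,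
  forall (a p D0 : 'I_N -> 'I_N -> R) (P : pred 'I_N) (jj : 'I_N -> 'I_N),
  (forall i, jj i != i) ->
  (forall i j, `|a i j| <= 1) ->
  (forall i j, 0 <= p i j) -> (forall i j, p i j = p j i) ->
  \sum_i \sum_(j | j != i) p i j = 1 ->
  (forall i j, 0 <= D0 i j) -> (forall i j, D0 i j = D0 j i) ->
  \sum_i \sum_(j | j != i) p i j * D0 i j <= 1 ->
  (forall i, 0 <= \sum_(j | j != i) p i j * a i j) ->
  (forall i, P i -> exists2 j, j != i & k1 <= p i j) ->
  exists n : 'I_N -> R, (forall i, `|n i| <= Rm%:R) /\
    forall (c : 'I_N -> 'I_N) (err : R), 0 <= err -> (forall i, c i != i) ->
      (forall i j, j != i ->
         D0 i (c i) + n i * a i (c i) + n (c i) * a (c i) i <=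
         D0 i j + n i * a i j + n j * a j i + err) ->
      - kap - N%:R * err <= \sum_(i | P i) a i (c i).
Proof.
move=> kap0 k10.
pose z : R := N.+1%:R * (2 + 2 / k1).
have z0 : 0 < z by rewrite mulr_gt0// addr_gt0// divr_gt0.
have eta0 : 0 < kap / z by rewrite divr_gt0.
pose Cn := (3 * (2 * N + 2) + 3)%N.
have [K HK] := exp_dominates_poly Cn (2 * N + 2) eta0.
pose Q := (K ^ 2).+1; pose W := ((2 * N + 2) * K.+1 ^ 2)%N.
exists Q => a p D0 P jj jjP a1 p0 psym psum D00 D0sym D0sum s0 pbig.
have cardT : #|{: {ffun 'I_N -> 'I_(2 * Q).+1} * 'I_W.+1}|%:R < (1 + kap / z) ^+ K.
  apply: le_lt_trans HK; rewrite ler_nat card_prod card_ffun !card_ord.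
  have pw x y n : (x <= y)%N -> (x ^ n <= y ^ n)%N by case: n => // n; rewrite leq_exp2r.
  have K1 : (0 < K.+1 ^ 2)%N by rewrite expn_gt0.
  have KK : (K ^ 2 <= K.+1 ^ 2)%N by rewrite leq_exp2r.
  have CE : ((Cn * K.+1) ^ 2 = Cn ^ 2 * K.+1 ^ 2)%N by rewrite expnMn.
  have C6 : (9 <= Cn ^ 2)%N by apply: (@leq_trans (3 ^ 2)); [|rewrite pw// /Cn leq_addl].
  have CN : (2 * N + 3 <= Cn ^ 2)%N.
    apply: (@leq_trans Cn); first by rewrite /Cn; lia.
    by rewrite expnS expn1 leq_pmull// /Cn addn3.
  rewrite expnD expnM leq_mul ?pw//.
    rewrite CE; apply: (@leq_trans (9 * K.+1 ^ 2)); last by rewrite leq_mul2r C6 orbT.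
    by rewrite /Q; lia.
  rewrite CE; apply: (@leq_trans ((2 * N + 3) * K.+1 ^ 2)); last by rewrite leq_mul2r CN orbT.
  by rewrite /W -[3%N]addn1 addnA [leqRHS]mulnDl mul1n; lia.
have [r [l [g [rQ Ag Hg]]]] := average_min_gap_shift jjP a1 p0 psym psum D00 D0sym D0sum s0 k10
  pbig eta0 erefl erefl cardT.
exists (offset g); split.
  move=> i; have /admissibleP[/(_ i) h _ _] := Ag; apply: (le_trans h).
  by rewrite ler_nat ltnW.
move=> c err err0 ci Hc.
have : \sum_(i | P i) (min_gap a D0 jj (shift i g) i - min_gap a D0 jj g i) <=
   \sum_(i | P i) (a i (c i) + err).
  apply: ler_sum => i Pi; apply: (min_gap_shift_le jjP rQ Ag (ci i)).
  by move=> j ji; have := Hc i j ji; rewrite /gap; lra.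
rewrite [leRHS]big_split/= sumr_const -[X in _ + X]mulr_natl.
have : #|P|%:R * err <= N%:R * err.
  by rewrite ler_wpM2r// ler_nat -[leqRHS]card_ord max_card.
have : N%:R * (2 + 2 / k1) * (kap / z) <= kap.
  have {2}-> : kap = z * (kap / z) by rewrite mulrC divfK// gt_eqF.
  by rewrite ler_wpM2r// ?(ltW eta0)// /z ler_wpM2r// ?ler_nat// addr_ge0// divr_ge0// ltW.
by lra.
Qed.

(** * Plane geometry *)

Section plane.
Context {R : realType}.
Implicit Types (u v w : 'I_2 -> R).

Definition dot u v : R := u ord0 * v ord0 + u ord_max * v ord_max.
Definition nrm u : R := Num.sqrt (dot u u).

Lemma dot_ge0 u : 0 <= dot u u.
Proof. by rewrite /dot -!expr2 addr_ge0// sqr_ge0. Qed.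

Lemma nrm_ge0 u : 0 <= nrm u. Proof. exact: sqrtr_ge0. Qed.

Lemma nrm_sqr u : nrm u * nrm u = dot u u.
Proof. by rewrite -expr2 sqr_sqrtr// dot_ge0. Qed.

Lemma dotC u v : dot u v = dot v u. Proof. by rewrite /dot; ring. Qed.

Lemma dotDr u v w : dot u (fun k => v k + w k) = dot u v + dot u w.
Proof. by rewrite /dot; ring. Qed.

Lemma dotZr u v (c : R) : dot u (fun k => c * v k) = c * dot u v.
Proof. by rewrite /dot; ring. Qed.

Lemma dot_nrm_le u v : `|dot u v| <= nrm u * nrm v.
Proof.
rewrite -ler_sqr ?nnegrE ?mulr_ge0 ?nrm_ge0// real_normK ?num_real//.
rewrite exprMn !expr2 !nrm_sqr /dot.
have := sqr_ge0 (u ord0 * v ord_max - u ord_max * v ord0); rewrite expr2; nra.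
Qed.

Lemma nrm_leP u (c : R) : 0 <= c -> (nrm u <= c) = (dot u u <= c * c).
Proof.
by move=> c0; rewrite -nrm_sqr -!expr2 ler_sqr ?nnegrE ?nrm_ge0.
Qed.

Lemma nrmD u v : nrm (fun k => u k + v k) <= nrm u + nrm v.
Proof.
have un := nrm_ge0 u; have vn := nrm_ge0 v.
rewrite nrm_leP ?addr_ge0//.
have := dot_nrm_le u v; rewrite ler_norml => /andP[_ h].
have := nrm_sqr u; have := nrm_sqr v; move: h; rewrite /dot; nra.
Qed.

Lemma nrmZ u (c : R) : nrm (fun k => c * u k) = `|c| * nrm u.
Proof.
rewrite /nrm (_ : dot _ _ = c ^+ 2 * dot u u); last by rewrite /dot; ring.
by rewrite sqrtrM ?sqr_ge0// sqrtr_sqr.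
Qed.

Lemma nrmN u : nrm (fun k => - u k) = nrm u.
Proof. by rewrite /nrm /dot !mulrNN. Qed.

Lemma nrmB u v : nrm (fun k => u k - v k) <= nrm u + nrm v.
Proof. by apply: (le_trans (nrmD _ _)); rewrite nrmN. Qed.

Lemma ord2P (k : 'I_2) : k = ord0 \/ k = ord_max.
Proof. by case: k => [[|[|//]] kl]; [left|right]; apply/val_inj. Qed.

Lemma coord_le_nrm u k : `|u k| <= nrm u.
Proof.
rewrite -[leLHS]sqrtr_sqr ler_wsqrtr// /dot -!expr2.
by case: (ord2P k) => ->; rewrite ?lerDl ?lerDr sqr_ge0.
Qed.

Lemma nrm_le_coord u (c : R) : (forall k, `|u k| <= c) -> nrm u <= 2 * c.
Proof.
move=> h; have c0 : 0 <= c by exact: le_trans (normr_ge0 _) (h ord0).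
rewrite nrm_leP ?mulr_ge0// /dot.
have := h ord0; have := h ord_max; rewrite !ler_norml => /andP[? ?] /andP[? ?]; nra.
Qed.

Lemma nrm_perturb_ge u v : 0 < nrm u -> nrm u + dot u v / nrm u <= nrm (fun k => u k + v k).
Proof.
move=> u0; rewrite -[X in X + _](mulfK (lt0r_neq0 u0)) -mulrDl ler_pdivrMr// mulrC.
rewrite nrm_sqr -dotDr; apply: le_trans (_ : `|dot u (fun k => u k + v k)| <= _); first exact: ler_norm.
by rewrite mulrC; exact: dot_nrm_le.
Qed.

Lemma nrm_perturb_le u v : 0 < nrm u ->
  nrm (fun k => u k + v k) <= nrm u + dot u v / nrm u + dot v v / (2 * nrm u).
Proof.
move=> u0; set s := nrm (fun k => _).
have ss : s * s = nrm u * nrm u + 2 * dot u v + dot v v.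
  by rewrite /s nrm_sqr nrm_sqr /dot; ring.
have -> : nrm u + dot u v / nrm u + dot v v / (2 * nrm u) =
   (nrm u * nrm u + s * s) / (2 * nrm u) by rewrite ss; field; rewrite gt_eqF.
rewrite ler_pdivlMr ?mulr_gt0//; have := sqr_ge0 (s - nrm u); rewrite expr2; nra.
Qed.

Lemma nrm_sum (I : Type) (r : seq I) (P : pred I) (F : I -> 'I_2 -> R) :
  nrm (fun k => \sum_(i <- r | P i) F i k) <= \sum_(i <- r | P i) nrm (F i).
Proof.
elim: r => [|i r IH].
  by rewrite big_nil /nrm /dot !big_nil mulr0 addr0 sqrtr0.
rewrite big_cons; have [Pi|nPi] := boolP (P i).
  apply: (@le_trans _ _ (nrm (fun k => F i k + \sum_(j <- r | P j) F j k))).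
    by rewrite /nrm /dot !big_cons Pi.
  by apply: (le_trans (nrmD _ _)); rewrite lerD2l.
by apply: le_trans IH; rewrite /nrm /dot !big_cons (negbTE nPi).
Qed.

Lemma dot_suml (I : Type) (r : seq I) (P : pred I) (F : I -> 'I_2 -> R) v :
  dot (fun k => \sum_(i <- r | P i) F i k) v = \sum_(i <- r | P i) dot (F i) v.
Proof. by rewrite /dot !mulr_suml -big_split. Qed.

Lemma agent_dist_nrm N (x : config R N) i j :
  agent_dist x i j = nrm (fun k => x i k - x j k).
Proof. by rewrite agent_distE /nrm /dot !expr2. Qed.

Lemma agent_distC N (x : config R N) i j : agent_dist x i j = agent_dist x j i.
Proof. by rewrite !agent_distE; congr Num.sqrt; ring. Qed.

Lemma force_scalar (xi m1 m dx d r : R) : 0 < m1 -> m1 <= m -> m <= dx ->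
  0 <= r -> 4 * r <= m1 -> `|d - dx| <= 2 * r ->
  `|(xi ^+ 2 / d ^+ 2 - 1) * dx - (xi ^+ 2 / m - m)| <=
  (12 * xi ^+ 2 / m1 ^+ 2 + 1) * ((dx - m) + r).
Proof.
move=> m10 m1m mdx r0 rm1; rewrite ler_norml => /andP[dl du].
have d0 : 0 < d by lra.
have dm : m1 / 2 <= d by lra.
have m0 : 0 < m by lra.
have X0 : 0 <= xi ^+ 2 by exact: sqr_ge0.
set X := xi ^+ 2 in X0 *.
have -> : (X / d ^+ 2 - 1) * dx - (X / m - m) =
    X * ((dx * m - d * d) / (d * d * m)) - (dx - m).
  by field; rewrite !gt_eqF.
have key : `|(dx * m - d * d) / (d * d * m)| <= 4 * ((dx - m) + 3 * r) / m1 ^+ 2.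
  rewrite normrM normfV (gtr0_norm (_ : 0 < d * d * m)) ?mulr_gt0//.
  have -> : dx * m - d * d = dx * (m - d) + d * (dx - d) by ring.
  have h1 : `|dx * (m - d) + d * (dx - d)| <= 2 * d * ((dx - m) + 2 * r) + d * (2 * r).
    apply: (le_trans (ler_normD _ _)); rewrite lerD//.
      by rewrite normrM ler_pM//; rewrite ler_norml; apply/andP; lra.
    by rewrite normrM (gtr0_norm d0) ler_pM2l// ler_norml; apply/andP; lra.
  apply: (le_trans (ler_wpM2r _ h1)); first by rewrite invr_ge0 !mulr_ge0 ?ltW.
  rewrite ler_pdivlMr ?exprn_gt0// mulrAC ler_pdivrMr ?mulr_gt0//.
  have h2 : 2 * d * ((dx - m) + 2 * r) + d * (2 * r) <= 2 * d * ((dx - m) + 3 * r) by nra.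
  apply: (le_trans (ler_wpM2r (sqr_ge0 m1) h2)).
  have h3 : m1 ^+ 2 <= 2 * (d * m) by rewrite expr2; nra.
  have h4 : 0 <= 2 * d * ((dx - m) + 3 * r) by rewrite !mulr_ge0 ?(ltW d0)//; lra.
  apply: (le_trans (ler_wpM2l h4 h3)).
  by rewrite le_eqVlt; apply/orP; left; apply/eqP; ring.
apply: (le_trans (ler_normB _ _)).
rewrite normrM (ger0_norm X0) (ger0_norm (_ : 0 <= dx - m)) ?subr_ge0//.
have := ler_wpM2l X0 key.
have h5 : 0 <= X / m1 ^+ 2 by rewrite divr_ge0// exprn_ge0// ltW.
have -> : X * (4 * (dx - m + 3 * r) / m1 ^+ 2) = 4 * (dx - m + 3 * r) * (X / m1 ^+ 2) by ring.
have -> : 12 * X / m1 ^+ 2 = 12 * (X / m1 ^+ 2) by ring.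
set Y := X / m1 ^+ 2 in h5 *; move=> h6.
have : 0 <= Y * (dx - m) by rewrite mulr_ge0// subr_ge0.
lra.
Qed.

End plane.

(** * A generic perturbation that does not decrease the minimal distance *)

Section repelling_step.
Context {R : realType}.
Variable N : nat.
Implicit Types (x y : config R N) (p : 'I_N -> 'I_N -> R).

Definition dir x i j (k : 'I_2) : R := (x i k - x j k) / agent_dist x i j.

Definition pull x p i (k : 'I_2) : R := \sum_(j | j != i) p i j * dir x i j k.

Lemma dirE x i j : dir x i j = (fun k => (agent_dist x i j)^-1 * (x i k - x j k)).
Proof. by apply/funext => k; rewrite /dir mulrC. Qed.

Lemma nrm_dir_le1 x i j : nrm (dir x i j) <= 1.
Proof.
rewrite dirE nrmZ -agent_dist_nrm ger0_norm ?invr_ge0 ?agent_dist_ge0//.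
by have [->|h] := eqVneq (agent_dist x i j) 0; rewrite ?mulr0// mulVf.
Qed.

Lemma dirC x i j k : dir x j i k = - dir x i j k.
Proof. by rewrite /dir agent_distC -mulNr opprB. Qed.

Lemma nrm_pull_le x p i : (forall i j, 0 <= p i j) ->
  nrm (pull x p i) <= \sum_(j | j != i) p i j.
Proof.
move=> p0; apply: (le_trans (nrm_sum _ _ _)); apply: ler_sum => j _.
by rewrite nrmZ ger0_norm// ler_piMr// nrm_dir_le1.
Qed.

Lemma dot_dir x i j (v : 'I_2 -> R) :
  dot v (fun k => x i k - x j k) = agent_dist x i j * dot v (dir x i j).
Proof.
have [d0|d0] := eqVneq (agent_dist x i j) 0; last first.
  rewrite -dotZr; congr dot; apply/funext => k; rewrite /dir mulrC divfK//.
rewrite d0 mul0r; apply/eqP; rewrite -normr_le0 (le_trans (dot_nrm_le _ _))//.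
by rewrite -agent_dist_nrm d0 mulr0.
Qed.

Definition rel_disp x y i j (k : 'I_2) : R := (y i k - x i k) - (y j k - x j k).

Lemma agent_dist_perturb x y i j : 0 < agent_dist x i j ->
  agent_dist x i j + dot (dir x i j) (rel_disp x y i j) <= agent_dist y i j <=
  agent_dist x i j + dot (dir x i j) (rel_disp x y i j)
  + dot (rel_disp x y i j) (rel_disp x y i j) / (2 * agent_dist x i j).
Proof.
move=> d0; set D := rel_disp x y i j.
have yE : agent_dist y i j = nrm (fun k => (x i k - x j k) + D k).
  by rewrite agent_dist_nrm; congr nrm; apply/funext => k; rewrite /D /rel_disp; ring.
have dotE : dot (fun k => x i k - x j k) D / agent_dist x i j = dot (dir x i j) D.
  by rewrite dotC dot_dir mulrC mulKf ?gt_eqF// dotC.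
rewrite yE -dotE agent_dist_nrm; rewrite agent_dist_nrm in d0.
by rewrite nrm_perturb_ge// nrm_perturb_le.
Qed.

Lemma repelling_step (xi m1 kap rho : R) : (2 <= N)%N ->
  0 < xi -> 0 < m1 -> 0 < kap -> 0 < rho ->
  exists2 tau, 0 < tau & forall x p m,
    m1 <= m -> m <= xi -> (forall i j, j != i -> m <= agent_dist x i j) ->
    (forall i j, 0 <= p i j) -> (forall i j, p i j = p j i) ->
    \sum_i \sum_(j | j != i) p i j = 1 ->
    \sum_i \sum_(j | j != i) p i j * (agent_dist x i j - m) <= tau ->
    exists y u, [/\ f_graph xi y u, forall i k, `|y i k - x i k| <= rho &
      - kap <= \sum_i dot (pull x p i) (u i)].
Proof.
move=> N2 xi0 m10 kap0 rho0.
pose Phi := xi ^+ 2 / m1.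
have Phi0 : 0 < Phi by rewrite divr_gt0// exprn_gt0.
pose kap2 := kap / (4 * (Phi + 1)).
have kap20 : 0 < kap2 by rewrite divr_gt0// mulr_gt0// addr_gt0.
pose k1 := kap2 / (N ^ 2).+1%:R.
have k10 : 0 < k1 by rewrite divr_gt0.
have [Rm HRm] := lattice_perturbation N kap20 k10.
pose Rr : R := Rm%:R + 2.
have Rr0 : 0 < Rr by rewrite /Rr ltr_wpDl.
pose E := 4 + 2 * Rr ^+ 2 / m1.
have E0 : 0 < E by rewrite addr_gt0// divr_gt0// mulr_gt0// exprn_gt0.
pose C2 := 12 * xi ^+ 2 / m1 ^+ 2 + 1.
have C20 : 0 < C2 by rewrite addr_gt0// divr_gt0 ?exprn_gt0// mulr_gt0// exprn_gt0.
pose G1 := 4 * xi ^+ 2 / m1 ^+ 2 + 1.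
have G10 : 0 < G1 by rewrite addr_gt0// divr_gt0 ?exprn_gt0// mulr_gt0// exprn_gt0.
pose Big := Phi * (N%:R * (2 * E)) + C2 * (1 + 5 * Rr) + 2 * (G1 * Rr) + 1.
have Big0 : 0 < Big.
  rewrite ltr_wpDl// addr_ge0 ?addr_ge0//; apply: mulr_ge0 => //; rewrite ?(ltW C20) ?(ltW Phi0)//.
  - by rewrite mulr_ge0// mulr_ge0// ltW.
  - by rewrite addr_ge0// mulr_ge0// ltW.
  - by rewrite mulr_ge0// ltW.
pose t := Num.min 1 (Num.min (m1 / (4 * Rr)) (Num.min (rho / Rr) (kap / (2 * Big)))).
have t0 : 0 < t by rewrite !lt_min ltr01 !divr_gt0// mulr_gt0.
have t1 : t <= 1 by rewrite /t ge_min lexx.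
have tm1 : 4 * (t * Rr) <= m1.
  rewrite mulrCA -ler_pdivlMr ?mulr_gt0//.
  by rewrite /t !ge_min lexx orbT.
have trho : t * Rr <= rho by rewrite -ler_pdivlMr// /t !ge_min lexx !orbT.
have tBig : Big * t <= kap / 2.
  have : t <= kap / (2 * Big) by rewrite /t !ge_min lexx !orbT.
  by rewrite ler_pdivlMr ?mulr_gt0//; lra.
exists t => // x p m m1m mxi mle p0 psym psum ptau.
have m0 : 0 < m by lra.
have dpos i j : j != i -> 0 < agent_dist x i j by move=> ji; apply: lt_le_trans (mle i j ji).
pose w := pull x p.
pose a i j := dot (w i) (dir x i j).
have wsum i : nrm (w i) <= \sum_(j | j != i) p i j by exact: nrm_pull_le.
have w1 i : nrm (w i) <= 1.
  apply: (le_trans (wsum i)); rewrite -psum [leRHS](bigD1 i)//= lerDl.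
  by apply: sumr_ge0 => k _; exact: sumr_ge0.
have aw i j : `|a i j| <= nrm (w i).
  by apply: (le_trans (dot_nrm_le _ _)); rewrite ler_piMr ?nrm_ge0// nrm_dir_le1.
have a1 i j : `|a i j| <= 1 by exact: le_trans (aw i j) (w1 i).
pose D0 i j := if j == i then 0 else (agent_dist x i j - m) / t.
have D00 i j : 0 <= D0 i j.
  by rewrite /D0; case: eqVneq => // ji; rewrite divr_ge0 ?subr_ge0 ?mle ?(ltW t0).
have D0sym i j : D0 i j = D0 j i by rewrite /D0 eq_sym agent_distC.
have D0sum : \sum_i \sum_(j | j != i) p i j * D0 i j <= 1.
  rewrite (_ : \sum_i _ = (\sum_i \sum_(j | j != i) p i j * (agent_dist x i j - m)) / t).
    by rewrite ler_pdivrMr// mul1r.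
  rewrite mulr_suml; apply: eq_bigr => i _; rewrite mulr_suml; apply: eq_bigr => j ji.
  by rewrite /D0 (negbTE ji) mulrA.
have s0 i : 0 <= \sum_(j | j != i) p i j * a i j.
  suff -> : \sum_(j | j != i) p i j * a i j = dot (w i) (w i) by exact: dot_ge0.
  rewrite -[RHS]/(dot (fun k => \sum_(j | j != i) p i j * dir x i j k) (w i)) dot_suml.
  by apply: eq_bigr => j _; rewrite [RHS]dotC dotZr.
(* The remaining agents have w_i almost 0 and contribute next to nothing. *)
pose P : pred 'I_N := fun i => [exists j, (j != i) && (k1 <= p i j)].
have pbig i : P i -> exists2 j, j != i & k1 <= p i j.
  by move=> /existsP[j /andP[ji pj]]; exists j.
have [jj jjP] : exists jj : 'I_N -> 'I_N, forall i, jj i != i.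
  have [z [gz _]] := generic_dense x ltr01.
  by have [c cP] := generic_closest N2 gz; exists c => i; have [] := cP i.
have [n [nRm Hn]] := HRm a p D0 P jj jjP a1 p0 psym psum D00 D0sym D0sum s0 pbig.
pose y0 : config R N := fun i k => x i k + t * (n i * w i k).
have tt0 : 0 < t ^+ 2 by rewrite exprn_gt0.
have [y [gy yy0]] := generic_dense y0 tt0.
have [c cP] := generic_closest N2 gy.
have ci i : c i != i by have [] := cP i.
have cmin i j : j != i -> agent_dist y i (c i) <= agent_dist y i j.
  by move=> ji; have [->//|jc] := eqVneq j (c i); apply/ltW; have [_] := cP i; apply.
pose del i k := y i k - x i k.
pose er i k := y i k - y0 i k.
have ner i : nrm (er i) <= 2 * t ^+ 2 by apply: nrm_le_coord => k; exact: yy0.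
have delE i : del i = (fun k => t * n i * w i k + er i k).
  by apply/funext => k; rewrite /del /er /y0; ring.
pose r := t * Rr.
have r0 : 0 < r by rewrite mulr_gt0.
have ndel i : nrm (del i) <= r.
  rewrite delE; apply: (le_trans (nrmD _ _)).
  have h1 : nrm (fun k => t * n i * w i k) <= t * Rm%:R.
    rewrite nrmZ normrM (gtr0_norm t0) -mulrA ler_pM2l//.
    by apply: (le_trans (ler_piMr _ (w1 i))).
  have h2 : 2 * t ^+ 2 <= t * 2 by rewrite expr2; nra.
  by rewrite /r /Rr mulrDr lerD// (le_trans (ner i)).
pose DD := rel_disp x y.
have nDD i j : nrm (DD i j) <= 2 * r.
  by apply: (le_trans (nrmB _ _)); have := ndel i; have := ndel j; lra.
have dDD i j : dot (dir x i j) (DD i j) =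
    t * (n i * a i j + n j * a j i) + (dot (dir x i j) (er i) - dot (dir x i j) (er j)).
  have -> : a j i = - dot (w j) (dir x i j).
    by rewrite /a (_ : dir x j i = (fun k => -1 * dir x i j k)) ?dotZr ?mulN1r//;
      apply/funext => k; rewrite dirC mulN1r.
  have DE k : DD i j k = del i k - del j k by [].
  by rewrite /a /dot !DE !delE /dot; ring.
have der i j l : `|dot (dir x i j) (er l)| <= 2 * t ^+ 2.
  apply: (le_trans (dot_nrm_le _ _)); apply: le_trans (ner l).
  by rewrite ler_piMl ?nrm_ge0// nrm_dir_le1.
have dyx i j : j != i ->
    `|agent_dist y i j - agent_dist x i j - t * (n i * a i j + n j * a j i)| <= t ^+ 2 * E.
  move=> ji; have := agent_dist_perturb y (dpos i j ji); rewrite -/(DD i j) dDD => /andP[h1 h2].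
  have := der i j i; have := der i j j; rewrite !ler_norml => /andP[? ?] /andP[? ?].
  have h3 : dot (DD i j) (DD i j) / (2 * agent_dist x i j) <= 2 * r ^+ 2 / m1.
    rewrite ler_pdivrMr ?mulr_gt0 ?dpos// mulrAC ler_pdivlMr//.
    have h4 : dot (DD i j) (DD i j) <= 4 * r ^+ 2.
      by rewrite -nrm_sqr; have := nDD i j; have := nrm_ge0 (DD i j); rewrite expr2; nra.
    have h5 : m1 <= agent_dist x i j by apply: le_trans (mle i j ji).
    apply: (le_trans (ler_wpM2r (ltW m10) h4)).
    rewrite [leRHS](_ : _ = 4 * r ^+ 2 * agent_dist x i j); last by ring.
    by rewrite ler_wpM2l// mulr_ge0// sqr_ge0.
  have h6 : t ^+ 2 * E = 4 * t ^+ 2 + 2 * r ^+ 2 / m1 by rewrite /E /r; ring.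
  have h7 : 0 <= 2 * r ^+ 2 / m1 by rewrite divr_ge0 ?ltW// mulr_gt0// exprn_gt0.
  by rewrite h6; apply/andP; split; lra.
have Hsum : - kap2 - N%:R * (2 * (t * E)) <= \sum_(i | P i) a i (c i).
  apply: Hn => //; first by rewrite !mulr_ge0 ?ltW.
  move=> i j ji; rewrite /D0 (negbTE ji) (negbTE (ci i)).
  have := dyx i j ji; have := dyx i (c i) (ci i); have := cmin i j ji.
  rewrite !ler_norml => h /andP[h1 _] /andP[_ h2].
  rewrite -(ler_pM2l t0).
  have -> : t * ((agent_dist x i (c i) - m) / t + n i * a i (c i) + n (c i) * a (c i) i) =
     (agent_dist x i (c i) - m) + t * (n i * a i (c i) + n (c i) * a (c i) i).
    by field; rewrite gt_eqF.
  have -> : t * ((agent_dist x i j - m) / t + n i * a i j + n j * a j i + 2 * (t * E)) =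
     (agent_dist x i j - m) + t * (n i * a i j + n j * a j i) + 2 * (t ^+ 2 * E).
    by field; rewrite gt_eqF.
  lra.
have Hall : - (2 * kap2) - N%:R * (2 * (t * E)) <= \sum_i a i (c i).
  rewrite (bigID P)/=; suff : - kap2 <= \sum_(i | ~~ P i) a i (c i) by lra.
  apply: (@le_trans _ _ (\sum_(i | ~~ P i) - (N%:R * k1))); last first.
    apply: ler_sum => i nPi; have := aw i (c i); rewrite ler_norml => /andP[h _].
    apply: le_trans h; rewrite lerN2 (le_trans (wsum i))//.
    apply: (@le_trans _ _ (\sum_(j | j != i) k1)).
      apply: ler_sum => j ji; rewrite leNgt; apply: contra nPi => kp.
      by apply/existsP; exists j; rewrite ji ltW.
    rewrite sumr_const -[leLHS]mulr_natl ler_wpM2r ?(ltW k10)// ler_nat.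
    by rewrite -[leqRHS]card_ord max_card.
  rewrite sumr_const mulNrn lerN2 -[leLHS]mulr_natl.
  apply: (@le_trans _ _ (N%:R * (N%:R * k1))).
    apply: ler_wpM2r; first by rewrite mulr_ge0// ltW.
    by rewrite ler_nat -[leqRHS]card_ord max_card.
  rewrite mulrA -natrM /k1 mulrCA ler_piMr ?(ltW kap20)// ler_pdivrMr// mul1r.
  by rewrite ler_nat -mulnn ltnW.
pose u := f_formula xi y c.
exists y, u; split.
- by split; [exact: gy.1|split; [exact: gy.2|exists c]].
- by move=> i k; apply: (le_trans (coord_le_nrm (del i) k)); exact: le_trans (ndel i) _.
have dxy i j : j != i -> `|agent_dist y i j - agent_dist x i j| <= 2 * r.
  move=> ji; rewrite !agent_dist_nrm.
  have h1 : nrm (fun k => y i k - y j k) <= nrm (fun k => x i k - x j k) + nrm (DD i j).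
    apply: le_trans (nrmD _ _); rewrite le_eqVlt; apply/orP; left; apply/eqP; congr nrm.
    by apply/funext => k; rewrite /DD /rel_disp; ring.
  have h2 : nrm (fun k => x i k - x j k) <= nrm (fun k => y i k - y j k) + nrm (DD i j).
    apply: le_trans (nrmB _ _); rewrite le_eqVlt; apply/orP; left; apply/eqP; congr nrm.
    by apply/funext => k; rewrite /DD /rel_disp; ring.
  by have := nDD i j; rewrite ler_norml => h; apply/andP; split; lra.
pose phi := xi ^+ 2 / m - m.
have phi_ge0 : 0 <= phi.
  by rewrite subr_ge0 ler_pdivlMr// expr2 ler_pM// ltW.
have phi_le : phi <= Phi.
  have : xi ^+ 2 / m <= Phi by rewrite ler_pM2l ?exprn_gt0// lef_pV2.
  by rewrite /phi; lra.
have Hone i : phi * a i (c i) - nrm (w i) *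
    (C2 * ((agent_dist x i (c i) - m) + r) + G1 * (2 * r)) <= dot (w i) (u i).
  set d := agent_dist y i (c i); set dx := agent_dist x i (c i).
  have d_dx : `|d - dx| <= 2 * r by exact: dxy.
  have mdx : m <= dx by exact: mle.
  have dm1 : m1 / 2 <= d by move: d_dx tm1; rewrite -/r ler_norml => /andP[? _]; lra.
  have d0 : 0 < d by lra.
  pose G := xi ^+ 2 / d ^+ 2 - 1.
  have uE : dot (w i) (u i) = G * dx * a i (c i) + G * dot (w i) (DD i (c i)).
    transitivity (G * dot (w i) (fun k => (x i k - x (c i) k) + DD i (c i) k)); last first.
      by rewrite dotDr dot_dir mulrDr mulrA.
    rewrite -dotZr; congr dot; apply/funext => k; rewrite /u /f_formula -/d /G /DD /rel_disp.
    by field; rewrite gt_eqF.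
  have hG : `|G| <= G1.
    have h1 : 0 <= xi ^+ 2 / d ^+ 2 by rewrite divr_ge0 ?exprn_ge0 ?ltW.
    have h2 : xi ^+ 2 / d ^+ 2 <= 4 * xi ^+ 2 / m1 ^+ 2.
      rewrite ler_pdivrMr ?exprn_gt0// mulrAC ler_pdivlMr ?exprn_gt0//.
      rewrite [leRHS](_ : _ = xi ^+ 2 * (4 * d ^+ 2)); last by ring.
      by apply: ler_wpM2l; [exact: sqr_ge0|rewrite !expr2; nra].
    by rewrite /G /G1 ler_norml; apply/andP; split; lra.
  have h1 : `|G * dx - phi| <= C2 * ((dx - m) + r).
    by apply: force_scalar => //; exact: ltW.
  have h2 : `|(G * dx - phi) * a i (c i)| <= C2 * ((dx - m) + r) * nrm (w i).
    by rewrite normrM ler_pM.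
  have h3 : `|G * dot (w i) (DD i (c i))| <= G1 * (nrm (w i) * (2 * r)).
    rewrite normrM ler_pM// (le_trans (dot_nrm_le _ _))// ler_wpM2l ?nrm_ge0//.
  rewrite uE; move: h2 h3; rewrite !ler_norml => /andP[h2 _] /andP[h3 _].
  lra.
have Hw : \sum_i nrm (w i) <= 1 by rewrite -psum; apply: ler_sum => i _.
have Hwd : \sum_i nrm (w i) * (agent_dist x i (c i) - m) <= t + 4 * r.
  apply: (@le_trans _ _ (\sum_i \sum_(j | j != i) p i j * ((agent_dist x i j - m) + 4 * r))).
    apply: ler_sum => i _.
    apply: (@le_trans _ _ ((\sum_(j | j != i) p i j) * (agent_dist x i (c i) - m))).
      by rewrite ler_wpM2r ?wsum// subr_ge0 mle.
    rewrite mulr_suml; apply: ler_sum => j ji; rewrite ler_wpM2l//.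
    have := dxy i (c i) (ci i); have := dxy i j ji; have := cmin i j ji.
    by rewrite !ler_norml => ? /andP[? ?] /andP[? ?]; lra.
  rewrite (_ : \sum_i _ = \sum_i \sum_(j | j != i) p i j * (agent_dist x i j - m) +
      (\sum_i \sum_(j | j != i) p i j) * (4 * r)); first by rewrite psum mul1r lerD2r.
  rewrite mulr_suml -big_split; apply: eq_bigr => i _.
  by rewrite mulr_suml -big_split; apply: eq_bigr => j _; rewrite mulrDr.
apply: le_trans (ler_sum _ (fun i _ => Hone i)).
rewrite (_ : \sum_i _ = phi * \sum_i a i (c i) -
   (C2 * \sum_i nrm (w i) * (agent_dist x i (c i) - m)
    + (C2 * r + G1 * (2 * r)) * \sum_i nrm (w i))); last first.
  rewrite !mulr_sumr -big_split/= -sumrB; apply: eq_bigr => i _; ring.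
have h1 : - (Phi * (2 * kap2 + N%:R * (2 * (t * E)))) <= phi * \sum_i a i (c i).
  have hh : 0 <= 2 * kap2 + N%:R * (2 * (t * E)).
    by have := mulr_ge0 (ler0n R N) (mulr_ge0 (ltW t0) (ltW E0)); lra.
  apply: (@le_trans _ _ (phi * - (2 * kap2 + N%:R * (2 * (t * E))))).
    by rewrite mulrN lerN2 ler_wpM2r.
  by rewrite ler_wpM2l//; lra.
have h2 := ler_wpM2l (ltW C20) Hwd.
have h3 : (C2 * r + G1 * (2 * r)) * \sum_i nrm (w i) <= C2 * r + G1 * (2 * r).
  rewrite ler_piMr//; have := mulr_ge0 (ltW C20) (ltW r0).
  by have := mulr_ge0 (ltW G10) (ltW r0); lra.
have h4 : Phi * (2 * kap2) <= kap / 2.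
  have -> : kap / 2 = (Phi + 1) * (2 * kap2).
    by rewrite /kap2; field; rewrite gt_eqF// addr_gt0.
  by apply: ler_wpM2r; lra.
have h5 : Phi * (N%:R * (2 * (t * E))) + C2 * (t + 4 * r) + (C2 * r + G1 * (2 * r)) <= Big * t.
  rewrite [leLHS](_ : _ = (Big - 1) * t); last by rewrite /Big /r; ring.
  by apply: ler_wpM2r; lra.
lra.
Qed.

End repelling_step.

(** * Euler polygons *)

Section euler_scheme.
Context {R : realType}.
Variable N : nat.
Implicit Types (x y u : config R N) (i j : 'I_N).

Lemma expR_le_quadratic (z : R) : `|z| <= 1 / 2 -> expR z <= 1 + z + 2 * z ^+ 2.
Proof.
rewrite ler_norml => /andP[z1 z2].
have h : 0 < 1 - z by lra.
have h1 : expR z * (1 - z) <= 1.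
  apply: (@le_trans _ _ (expR z * expR (- z))); last by rewrite -expRD subrr expR0.
  by rewrite ler_pM2l ?expR_gt0//; exact: expR_ge1Dx.
rewrite -(ler_pM2r h); apply: (le_trans h1).
have := sqr_ge0 z; rewrite expr2; nra.
Qed.

Lemma mul_expRN_le1 (z : R) : 0 <= z -> z * expR (- z) <= 1.
Proof.
move=> z0; rewrite expRN ler_pdivrMr ?expR_gt0// mul1r.
by apply: le_trans (expR_ge1Dx z); lra.
Qed.

Definition cfg_move x (h : R) u : config R N := fun i k => x i k + h * u i k.

Definition energy (q : R) x : R :=
  \sum_i \sum_(j | j != i) expR (- (q * agent_dist x i j)).

Definition weight q x i j : R := expR (- (q * agent_dist x i j)) / energy q x.

Lemma energy_term_le q x i j : j != i -> expR (- (q * agent_dist x i j)) <= energy q x.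
Proof.
move=> ji; rewrite /energy (bigD1 i)//= (bigD1 j)//= -addrA lerDl addr_ge0//.
  by apply: sumr_ge0 => k _; exact: expR_ge0.
by apply: sumr_ge0 => k _; apply: sumr_ge0 => l _; exact: expR_ge0.
Qed.

Lemma energy_gt0 q x i j : j != i -> 0 < energy q x.
Proof. by move=> ji; apply: lt_le_trans (energy_term_le q x ji); exact: expR_gt0. Qed.

Lemma energy_le q x (d : R) : 0 <= q -> (forall i j, j != i -> d <= agent_dist x i j) ->
  energy q x <= (N * N)%:R * expR (- (q * d)).
Proof.
move=> q0 h; apply: (@le_trans _ _ (\sum_(i < N) \sum_(j < N) expR (- (q * d)))).
  apply: ler_sum => i _; rewrite [leRHS](bigID (fun j => j != i))/=.
  apply: ler_wpDr; first by apply: sumr_ge0 => j _; exact: expR_ge0.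
  by apply: ler_sum => j ji; rewrite ler_expR lerN2 ler_wpM2l// h.
by rewrite !sumr_const !card_ord -mulrnA mulr_natl.
Qed.

Lemma weight_ge0 q x i j : 0 <= weight q x i j.
Proof.
rewrite /weight divr_ge0 ?expR_ge0//.
by apply: sumr_ge0 => k _; apply: sumr_ge0 => l _; exact: expR_ge0.
Qed.

Lemma weight_sym q x i j : weight q x i j = weight q x j i.
Proof. by rewrite /weight agent_distC. Qed.

Lemma weight_sum q x : 0 < energy q x -> \sum_i \sum_(j | j != i) weight q x i j = 1.
Proof.
move=> e0; rewrite /weight; under eq_bigr do rewrite -mulr_suml.
by rewrite -mulr_suml divff// gt_eqF.
Qed.

Lemma weight_gap q x i0 j0 : 0 < q -> j0 != i0 ->
  (forall i j, j != i -> agent_dist x i0 j0 <= agent_dist x i j) ->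
  \sum_i \sum_(j | j != i) weight q x i j * (agent_dist x i j - agent_dist x i0 j0)
    <= (N * N)%:R / q.
Proof.
move=> q0 ji0; set m := agent_dist x i0 j0 => hm.
have e0 := energy_gt0 q x ji0.
apply: (@le_trans _ _ (\sum_(i < N) \sum_(j < N) q^-1)); last first.
  by rewrite !sumr_const !card_ord -mulrnA mulr_natl.
apply: ler_sum => i _; rewrite [leRHS](bigID (fun j => j != i))/=.
apply: ler_wpDr; first by apply: sumr_ge0 => j _; rewrite invr_ge0 ltW.
apply: ler_sum => j ji; set d := agent_dist x i j.
have md : 0 <= d - m by rewrite subr_ge0 hm.
apply: (@le_trans _ _ (expR (- (q * (d - m))) * (d - m))).
  rewrite ler_wpM2r// /weight ler_pdivrMr// -/d.
  have -> : - (q * d) = - (q * (d - m)) + - (q * m) by ring.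
  by rewrite expRD ler_pM2l ?expR_gt0//; exact: energy_term_le.
rewrite -[leRHS]mul1r ler_pdivlMr//.
rewrite [leLHS](_ : _ = q * (d - m) * expR (- (q * (d - m)))); last by ring.
by apply: mul_expRN_le1; rewrite mulr_ge0// ltW.
Qed.

Lemma agent_dist_move_ge x u h i j : 0 < agent_dist x i j ->
  agent_dist x i j + h * (dot (dir x i j) (u i) - dot (dir x i j) (u j)) <=
  agent_dist (cfg_move x h u) i j.
Proof.
move=> d0; have /andP[+ _] := agent_dist_perturb (cfg_move x h u) d0.
congr (_ + _ <= _); rewrite /rel_disp /cfg_move /dot; ring.
Qed.

Lemma dot_dir_le x i j (v : 'I_2 -> R) : `|dot (dir x i j) v| <= nrm v.
Proof.
by apply: (le_trans (dot_nrm_le _ _)); rewrite ler_piMl ?nrm_ge0// nrm_dir_le1.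
Qed.

Lemma energy_step x u (h q Lam : R) i0 j0 : j0 != i0 -> 0 < h -> 0 < q ->
  (forall i j, j != i -> 0 < agent_dist x i j) ->
  (forall i, nrm (u i) <= Lam) -> 4 * (q * h * Lam) <= 1 ->
  energy q (cfg_move x h u) <= energy q x *
    (1 - 2 * (q * h) * \sum_i dot (pull x (weight q x) i) (u i) + 8 * (q * h * Lam) ^+ 2).
Proof.
move=> ji0 h0 q0 dpos uL small.
have e0 := energy_gt0 q x ji0.
pose z i j := - (q * h * (dot (dir x i j) (u i) - dot (dir x i j) (u j))).
have qh0 : 0 < q * h by rewrite mulr_gt0.
have zle i j : `|z i j| <= 2 * (q * h * Lam).
  rewrite /z normrN normrM (gtr0_norm qh0) mulrCA ler_pM2l//.
  apply: (le_trans (ler_normB _ _)).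
  have := dot_dir_le x i j (u i); have := dot_dir_le x i j (u j).
  by have := uL i; have := uL j; lra.
have term i j : j != i -> expR (- (q * agent_dist (cfg_move x h u) i j)) <=
    expR (- (q * agent_dist x i j)) * (1 + z i j + 8 * (q * h * Lam) ^+ 2).
  move=> ji; apply: (@le_trans _ _ (expR (- (q * agent_dist x i j) + z i j))).
    rewrite ler_expR /z -opprD lerN2 -mulrA -mulrDr ler_pM2l//.
    exact: agent_dist_move_ge (dpos i j ji).
  rewrite expRD ler_pM2l ?expR_gt0//; apply: (le_trans (expR_le_quadratic _)).
    by apply: (le_trans (zle i j)); lra.
  rewrite lerD2l; have -> : 8 * (q * h * Lam) ^+ 2 = 2 * (2 * (q * h * Lam)) ^+ 2 by ring.
  rewrite ler_pM2l// -[leLHS]real_normK ?num_real// ler_sqr ?nnegrE ?(le_trans _ (zle i j))//.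
apply: (@le_trans _ _ (\sum_i \sum_(j | j != i)
   expR (- (q * agent_dist x i j)) * (1 + z i j + 8 * (q * h * Lam) ^+ 2))).
  by apply: ler_sum => i _; apply: ler_sum => j; exact: term.
rewrite le_eqVlt; apply/orP; left; apply/eqP.
have wE i j : expR (- (q * agent_dist x i j)) = energy q x * weight q x i j.
  by rewrite /weight [RHS]mulrC divfK// gt_eqF.
have -> : \sum_i \sum_(j | j != i)
     expR (- (q * agent_dist x i j)) * (1 + z i j + 8 * (q * h * Lam) ^+ 2) =
   energy q x * (\sum_i \sum_(j | j != i) weight q x i j * z i j
     + (\sum_i \sum_(j | j != i) weight q x i j) * (1 + 8 * (q * h * Lam) ^+ 2)).
  under eq_bigr do under eq_bigr do rewrite wE.
  move: (energy q x) => S; rewrite mulrDr mulr_suml !mulr_sumr -big_split/=.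
  apply: eq_bigr => i _; rewrite mulr_suml !mulr_sumr -big_split/=.
  by apply: eq_bigr => j _; ring.
rewrite weight_sum// mul1r; congr (_ * _).
suff -> : \sum_i \sum_(j | j != i) weight q x i j * z i j =
    - (2 * (q * h) * \sum_i dot (pull x (weight q x) i) (u i)) by ring.
have pE i : dot (pull x (weight q x) i) (u i) =
    \sum_(j | j != i) weight q x i j * dot (dir x i j) (u i).
  rewrite /pull dot_suml; apply: eq_bigr => j _; rewrite dotC dotZr dotC//.
have -> : \sum_i \sum_(j | j != i) weight q x i j * z i j =
   - (q * h) * (\sum_i \sum_(j | j != i) weight q x i j * dot (dir x i j) (u i)
     + \sum_i \sum_(j | j != i) weight q x i j * dot (dir x j i) (u j)).
  rewrite -big_split mulr_sumr/=; apply: eq_bigr => i _.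
  rewrite -big_split mulr_sumr/=; apply: eq_bigr => j _ /=.
  have -> : dot (dir x j i) (u j) = - dot (dir x i j) (u j).
    by rewrite /dot !(dirC x i j); ring.
  by rewrite /z; ring.
have -> : \sum_i \sum_(j | j != i) weight q x i j * dot (dir x j i) (u j) =
   \sum_i \sum_(j | j != i) weight q x i j * dot (dir x i j) (u i).
  rewrite (exchange_big_dep predT)//=; apply: eq_bigr => i _.
  by apply: eq_big => [j|j _]; [rewrite eq_sym|rewrite weight_sym].
under [in RHS]eq_bigr do rewrite pE.
ring.
Qed.

Lemma min_agent_dist x : (2 <= N)%N -> exists i0 j0, j0 != i0 /\
  forall i j, j != i -> agent_dist x i0 j0 <= agent_dist x i j.
Proof.
move=> N2.
have [i1 [j1 ij1]] : exists i j : 'I_N, j != i.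
  by case: N N2 {x} => [//|[//|n]] _; exists ord0, ord_max.
have := @arg_minP _ _ _ (i1, j1) (fun z : 'I_N * 'I_N => z.2 != z.1)
  (fun z => agent_dist x z.1 z.2) ij1.
case=> [[i0 j0]] /= h1 h2; exists i0, j0; split=> // i j ji.
exact: (h2 (i, j)).
Qed.

Lemma agent_dist_lip x y i j :
  `|agent_dist y i j - agent_dist x i j| <=
  nrm (fun k => y i k - x i k) + nrm (fun k => y j k - x j k).
Proof.
rewrite !agent_dist_nrm; set e := nrm (fun k => y i k - x i k) + _.
have hD : nrm (rel_disp x y i j) <= e by exact: nrmB.
have h1 : nrm (fun k => y i k - y j k) <= nrm (fun k => x i k - x j k) + nrm (rel_disp x y i j).
  apply: le_trans (nrmD _ _); rewrite le_eqVlt; apply/orP; left; apply/eqP; congr nrm.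
  by apply/funext => k; rewrite /rel_disp; ring.
have h2 : nrm (fun k => x i k - x j k) <= nrm (fun k => y i k - y j k) + nrm (rel_disp x y i j).
  apply: le_trans (nrmB _ _); rewrite le_eqVlt; apply/orP; left; apply/eqP; congr nrm.
  by apply/funext => k; rewrite /rel_disp; ring.
by rewrite ler_norml; apply/andP; split; lra.
Qed.

Lemma force_bound (xi m1 rho M h : R) x y u : 0 < m1 -> 0 <= rho -> rho <= 1 -> 8 * rho <= m1 ->
  (forall i j, j != i -> m1 <= agent_dist x i j) ->
  (forall i k, `|x i k| <= M) -> (forall i k, `|y i k - x i k| <= rho) ->
  f_graph xi y u -> 0 <= h -> h <= 1 ->
  forall i k, `|u i k| <= 2 * M + (2 + 2 * xi ^+ 2 / m1) /\
    `|cfg_move x h u i k| <= M + h * (2 + 2 * xi ^+ 2 / m1).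
Proof.
move=> m10 rho0 rho1 rhom1 dm1 xM yx [_ [_ [c [cP uE]]]] h0 h1 i k.
have [ci _] := cP i.
set d := agent_dist y i (c i).
have dge : m1 / 2 <= d.
  have := agent_dist_lip x y i (c i).
  have := nrm_le_coord (yx i); have := nrm_le_coord (yx (c i)); have := dm1 i (c i) ci.
  by rewrite ler_norml -/d => ? ? ? /andP[? _]; lra.
have d0 : 0 < d by lra.
pose g := xi ^+ 2 * (y (c i) k - y i k) / d ^+ 2.
have gle : `|g| <= 2 * xi ^+ 2 / m1.
  have hy : `|y (c i) k - y i k| <= d.
    by rewrite distrC /d agent_dist_nrm; exact: (coord_le_nrm (fun k => y i k - y (c i) k)).
  rewrite /g normrM normrM normfV (ger0_norm (sqr_ge0 xi)) (ger0_norm (sqr_ge0 d)).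
  rewrite ler_pdivrMr ?exprn_gt0// [leRHS]mulrAC ler_pdivlMr//.
  have X0 := sqr_ge0 xi; set X := xi ^+ 2 in X0 *.
  apply: (@le_trans _ _ (X * d * m1)); first by rewrite ler_wpM2r ?(ltW m10)// ler_wpM2l.
  have : X * d * m1 <= X * d * (2 * d).
    by apply: ler_wpM2l; [exact: mulr_ge0 X0 (ltW d0)|lra].
  by move/le_trans; apply; rewrite le_eqVlt; apply/orP; left; apply/eqP; ring.
have -> : u i k = (y (c i) k - y i k) - g by rewrite uE.
rewrite /cfg_move uE /f_formula -/d -/g.
have := yx i k; have := yx (c i) k; have := xM i k; have := xM (c i) k; move: gle.
move: (y (c i) k) (y i k) (x (c i) k) (x i k) g => yc yi xc xx g0.
move: (2 * xi ^+ 2 / m1) => C; rewrite !ler_norml.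
move=> /andP[? ?] /andP[? ?] /andP[? ?] /andP[? ?] /andP[? ?].
by split; apply/andP; split; nra.
Qed.


Lemma euler_step (xi T eps ms M0 : R) : (2 <= N)%N -> 0 < xi -> 0 < T -> 0 < eps ->
  0 < ms -> ms <= xi -> 0 <= M0 ->
  let m1 := ms / 2 in let C := 2 + 2 * xi ^+ 2 / m1 in
  exists h q kap : R, [/\ 0 < h, h <= eps, 0 < q, 0 < kap &
  let B k := (N * N)%:R * expR (- (q * (ms - ms / 8))) * expR (3 * (q * kap * (k%:R * h))) in
  forall (k : nat) x, k%:R * h <= T -> (forall i l, `|x i l| <= M0 + C * (k%:R * h)) ->
    energy q x <= B k ->
    (forall i j, j != i -> m1 <= agent_dist x i j) /\
    exists y u, [/\ f_graph xi y u, forall i l, `|y i l - x i l| <= eps,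
      forall i l, `|u i l| <= 2 * (M0 + C * (k%:R * h)) + C,
      forall i l, `|cfg_move x h u i l| <= M0 + C * (k.+1%:R * h) &
      energy q (cfg_move x h u) <= B k.+1]].
Proof.
move=> N2 xi0 T0 eps0 ms0 msxi M00 m1 C.
have m10 : 0 < m1 by rewrite /m1 divr_gt0.
have C0 : 0 < C by rewrite addr_gt0// divr_gt0// mulr_gt0// exprn_gt0.
pose rho := Num.min eps (Num.min 1 (m1 / 8)).
have rho0 : 0 < rho by rewrite !lt_min eps0 ltr01 divr_gt0.
have rhoeps : rho <= eps by rewrite ge_min lexx.
have rho1 : rho <= 1 by rewrite !ge_min lexx orbT.
have rhom1 : 8 * rho <= m1.
  by rewrite mulrC -ler_pdivlMr// !ge_min lexx !orbT.
pose Lam := 2 * (2 * (M0 + C * T) + C).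
have Lam0 : 0 < Lam.
  by rewrite mulr_gt0// ltr_wpDl// mulr_ge0// addr_ge0// mulr_ge0// ltW.
pose kap := ms / (24 * T).
have kap0 : 0 < kap by rewrite divr_gt0// mulr_gt0.
have [tau tau0 Hstep] := repelling_step N2 xi0 m10 kap0 rho0.
have NN0 : 0 < (N * N)%:R :> R by rewrite ltr0n muln_gt0 (ltnW N2).
pose q := 8 * (N * N)%:R / ms + (N * N)%:R / tau.
have q0 : 0 < q by rewrite addr_gt0// divr_gt0// mulr_gt0.
have qms : (N * N)%:R / q <= ms / 8.
  rewrite ler_pdivrMr//.
  have -> : ms / 8 * q = (N * N)%:R + ms / 8 * ((N * N)%:R / tau).
    by rewrite /q; field; rewrite !gt_eqF.
  by rewrite lerDl mulr_ge0 ?divr_ge0 ?ltW.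
have qtau : (N * N)%:R / q <= tau.
  rewrite ler_pdivrMr//.
  have -> : tau * q = (N * N)%:R + tau * (8 * (N * N)%:R / ms).
    by rewrite /q; field; rewrite !gt_eqF.
  by rewrite lerDl mulr_ge0 ?divr_ge0 ?mulr_ge0 ?ltW.
have kapT : 3 * (kap * T) = ms / 8 by rewrite /kap; field; rewrite gt_eqF.
clearbody q kap.
pose h := Num.min eps (Num.min 1 (Num.min (1 / (4 * (q * Lam)))
   (Num.min (kap / (8 * (q * Lam ^+ 2))) (ms / (32 * Lam))))).
have h0 : 0 < h.
  by rewrite !lt_min eps0 ltr01 !divr_gt0 ?ltr01//; do ?[apply: mulr_gt0 => //]; exact: mulr_gt0.
have [heps h1 hs' hq' hm'] : [/\ h <= eps, h <= 1, h <= 1 / (4 * (q * Lam)),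
    h <= kap / (8 * (q * Lam ^+ 2)) & h <= ms / (32 * Lam)].
  by split; rewrite /h !ge_min lexx ?orbT.
have qL : 0 < q * Lam ^+ 2 by rewrite mulr_gt0// exprn_gt0.
have hs : 4 * (q * h * Lam) <= 1.
  rewrite [leLHS](_ : _ = h * (4 * (q * Lam))); last by ring.
  by rewrite -ler_pdivlMr// mulr_gt0// mulr_gt0.
have hq : 8 * (q * h * Lam) ^+ 2 <= q * h * kap.
  rewrite [leLHS](_ : _ = q * h * (h * (8 * (q * Lam ^+ 2)))); last by ring.
  rewrite ler_pM2l ?mulr_gt0//.
  by rewrite -ler_pdivlMr// mulr_gt0.
have hm : 2 * (h * Lam) <= ms / 16.
  have : h * (32 * Lam) <= ms by rewrite -ler_pdivlMr// mulr_gt0.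
  lra.
clearbody h.
exists h, q, kap; split=> // B k x kT xM eB.
set M := M0 + C * (k%:R * h) in xM *.
have kh0 : 0 <= k%:R * h by rewrite mulr_ge0// ltW.
have MT : M <= M0 + C * T by rewrite lerD2l ler_wpM2l// ltW.
have dge i j : j != i -> m1 <= agent_dist x i j.
  move=> ji; have := le_trans (energy_term_le q x ji) eB.
  have : B k <= expR (- (q * (5 / 8 * ms))).
    apply: (@le_trans _ _ (expR (N * N)%:R * expR (- (q * (ms - ms / 8))) *
        expR (3 * (q * kap * (k%:R * h))))).
      rewrite ler_wpM2r ?expR_ge0// ler_wpM2r ?expR_ge0//.
      by apply: le_trans (expR_ge1Dx _); rewrite lerDr.
    rewrite -!expRD ler_expR.
    have e1 : (N * N)%:R <= q * (ms / 8) by move: qms; rewrite ler_pdivrMr// mulrC.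
    have e2 : q * (kap * (k%:R * h)) <= q * (kap * T) by rewrite ler_pM2l// ler_pM2l.
    have e3 : q * (3 * (kap * T)) = q * (ms / 8) by rewrite kapT.
    by lra.
  move=> e1 e2; have := le_trans e2 e1; rewrite ler_expR lerN2 ler_pM2l// /m1; lra.
split=> //.
have [i0 [j0 [ji0 dmin]]] := min_agent_dist x N2.
set m := agent_dist x i0 j0 in dmin.
have key y u : f_graph xi y u -> (forall i l, `|y i l - x i l| <= rho) ->
   ((forall i, nrm (u i) <= Lam) -> energy q (cfg_move x h u) <= B k.+1) ->
   exists y u, [/\ f_graph xi y u, forall i l, `|y i l - x i l| <= eps,
      forall i l, `|u i l| <= 2 * M + C,
      forall i l, `|cfg_move x h u i l| <= M0 + C * (k.+1%:R * h) &
      energy q (cfg_move x h u) <= B k.+1].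
  move=> fyu yx He.
  have fb := force_bound m10 (ltW rho0) rho1 rhom1 dge xM yx fyu (ltW h0) h1.
  exists y, u; split=> //.
  - by move=> i l; exact: le_trans (yx i l) rhoeps.
  - by move=> i l; have [] := fb i l.
  - move=> i l; have [_ hb] := fb i l; apply: (le_trans hb).
    by rewrite -/C /M -natr1 le_eqVlt; apply/orP; left; apply/eqP; ring.
  apply: He => i; apply: (@le_trans _ _ (2 * (2 * M + C))).
    by apply: nrm_le_coord => l; have [] := fb i l.
  by rewrite /Lam ler_pM2l// lerD2r ler_pM2l.
have BS : B k.+1 = B k * expR (3 * (q * kap * h)).
  by rewrite /B -natr1 -[RHS]mulrA -expRD; congr (_ * expR _); ring.
(* Only below ms is the choice of the perturbation relevant. *)
have [mbig|msmall] := leP (ms - ms / 16) m.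
  have [y [gy yx]] := generic_dense x rho0.
  have [c cP] := generic_closest N2 gy.
  apply: (key y (f_formula xi y c)) => //.
    by split; [exact: gy.1|split; [exact: gy.2|exists c]].
  move=> uL; apply: (@le_trans _ _ ((N * N)%:R * expR (- (q * (ms - ms / 8))))).
    apply: energy_le; first exact: ltW.
    move=> i j ji; have d0 : 0 < agent_dist x i j by apply: lt_le_trans (dge i j ji).
    apply: le_trans (agent_dist_move_ge _ _ d0).
    set u := f_formula xi y c in uL *.
    have e1 := dot_dir_le x i j (u i); have e2 := dot_dir_le x i j (u j).
    have : `|h * (dot (dir x i j) (u i) - dot (dir x i j) (u j))| <= h * (2 * Lam).
      rewrite normrM (gtr0_norm h0) ler_pM2l//; apply: (le_trans (ler_normB _ _)).
      by have := uL i; have := uL j; lra.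
    rewrite ler_norml => /andP[e3 _]; have := dmin i j ji; lra.
  rewrite /B ler_peMr ?mulr_ge0 ?expR_ge0//.
  rewrite -expR0 ler_expR !mulr_ge0// ltW//.
have m1m : m1 <= m by exact: dge.
have mxi : m <= xi by lra.
have e0 := energy_gt0 q x ji0.
have [y [u [fyu yx Hu]]] := Hstep x (weight q x) m m1m mxi dmin (weight_ge0 q x)
  (weight_sym q x) (weight_sum e0) (le_trans (weight_gap q0 ji0 dmin) qtau).
apply: (key y u) => // uL.
have dpos i j : j != i -> 0 < agent_dist x i j by move=> ji; apply: lt_le_trans (dge i j ji).
apply: (le_trans (energy_step ji0 h0 q0 dpos uL hs)).
rewrite BS; apply: le_trans (ler_wpM2r (expR_ge0 _) eB).
apply: ler_wpM2l; first exact: ltW.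
apply: le_trans (expR_ge1Dx _).
have qh0 : 0 < q * h by rewrite mulr_gt0.
have : q * h * (- kap) <= q * h * \sum_i dot (pull x (weight q x) i) (u i) by rewrite ler_pM2l.
lra.
Qed.

Lemma euler_scheme (xi T eps ms M0 : R) (x0 : config R N) : (2 <= N)%N -> 0 < xi -> 0 < T ->
  0 < eps -> 0 < ms -> ms <= xi -> (forall i j, j != i -> ms <= agent_dist x0 i j) ->
  0 <= M0 -> (forall i l, `|x0 i l| <= M0) ->
  let m1 := ms / 2 in let C := 2 + 2 * xi ^+ 2 / m1 in
  exists (h : R) (xs ys us : nat -> config R N), [/\ 0 < h, h <= eps, xs 0%N = x0 &
  forall k : nat, k%:R * h <= T ->
    [/\ xs k.+1 = cfg_move (xs k) h (us k), f_graph xi (ys k) (us k),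
      forall i l, `|ys k i l - xs k i l| <= eps,
      forall i l, `|us k i l| <= 2 * (M0 + C * (k%:R * h)) + C &
      (forall i l, `|xs k i l| <= M0 + C * (k%:R * h)) /\
      (forall i j, j != i -> m1 <= agent_dist (xs k) i j)]].
Proof.
move=> N2 xi0 T0 eps0 ms0 msxi dx0 M00 x0M m1 C.
have [h [q [kap [h0 heps q0 kap0]]]] := euler_step N2 xi0 T0 eps0 ms0 msxi M00.
rewrite -/m1 -/C; set B := fun k => _ => Hstep.
have H1 (kx : nat * config R N) : exists yu : config R N * config R N,
  kx.1%:R * h <= T -> (forall i l, `|kx.2 i l| <= M0 + C * (kx.1%:R * h)) ->
  energy q kx.2 <= B kx.1 ->
  [/\ f_graph xi yu.1 yu.2, forall i l, `|yu.1 i l - kx.2 i l| <= eps,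
      forall i l, `|yu.2 i l| <= 2 * (M0 + C * (kx.1%:R * h)) + C,
      forall i l, `|cfg_move kx.2 h yu.2 i l| <= M0 + C * (kx.1.+1%:R * h) &
      energy q (cfg_move kx.2 h yu.2) <= B kx.1.+1].
  have [H|H] := pselect [/\ kx.1%:R * h <= T,
      (forall i l, `|kx.2 i l| <= M0 + C * (kx.1%:R * h)) & energy q kx.2 <= B kx.1].
    have [h1 h2 h3] := H; have [_ [y [u yu]]] := Hstep _ _ h1 h2 h3.
    by exists (y, u).
  by exists (x0, x0) => h1 h2 h3; case: H.
have [F HF] := choice H1.
pose xs := fix xs k := if k is k'.+1 then cfg_move (xs k') h (F (k', xs k')).2 else x0.
have inv k : k%:R * h <= T ->
    (forall i l, `|xs k i l| <= M0 + C * (k%:R * h)) /\ energy q (xs k) <= B k.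
  elim: k => [_|k IH kT].
    split; first by move=> i l; rewrite mul0r mulr0 addr0; exact: x0M.
    rewrite /B mul0r !mulr0 expR0 mulr1; apply: energy_le; first exact: ltW.
    by move=> i j ji; apply: le_trans (dx0 i j ji); lra.
  have kT' : k%:R * h <= T by apply: le_trans kT; rewrite ler_pM2r// ler_nat.
  have [i1 i2] := IH kT'.
  by have [_ _ _ h4 h5] := HF (k, xs k) kT' i1 i2.
exists h, xs, (fun k => (F (k, xs k)).1), (fun k => (F (k, xs k)).2); split=> // k kT.
have [i1 i2] := inv k kT; have [h1 h2 h3 h4 h5] := HF (k, xs k) kT i1 i2.
by split=> //; split=> //; have [] := Hstep k (xs k) kT i1 i2.
Qed.

End euler_scheme.

(** * Passage to the limit *)

Section avoiding_null_sets.
Context {R : realType}.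
Variable N : nat.
Implicit Types (x y u : config R N) (i j : 'I_N).

Lemma cfg_norm_le x (e : R) : (0 < N)%N -> (forall i k, `|x i k| <= e) ->
  cfg_norm x <= (2 * N)%:R * e.
Proof.
move=> N0 h; have e0 : 0 <= e by exact: le_trans (normr_ge0 _) (h (Ordinal N0) ord0).
rewrite -[leRHS]ger0_norm ?mulr_ge0// -sqrtr_sqr ler_wsqrtr//.
apply: (@le_trans _ _ (\sum_(i < N) \sum_(k < 2) e ^+ 2)).
  apply: ler_sum => i _; apply: ler_sum => k _.
  by rewrite -[leLHS]real_normK ?num_real// ler_sqr ?nnegrE.
rewrite !sumr_const !card_ord -mulrnA -[leLHS]mulr_natl exprMn.
apply: ler_wpM2r; first exact: sqr_ge0.
by rewrite -natrX ler_nat -mulnn leq_pmulr// muln_gt0.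
Qed.

Lemma f_graph_avoid (L : set (config R N)) (xi e : R) y u :
  cfg_null L -> 0 < e -> f_graph xi y u ->
  exists y' u', [/\ f_graph xi y' u', ~ L y', forall i k, `|y' i k - y i k| <= e &
    forall i k, `|u' i k - u i k| <= e].
Proof.
move=> nL e0 [nd [ns [c [cP uE]]]].
have H (n : nat) : exists z, ~ L z /\ forall i k, `|z i k - y i k| <= n.+1%:R^-1.
  by apply: cfg_null_avoid => //; rewrite invr_gt0.
have [z Hz] := choice H.
have zy i k : z n i k @[n --> \oo] --> y i k.
  apply/cvgrPdist_lt => r r0; near=> n; rewrite distrC; have [_ h] := Hz n.
  by apply: (le_lt_trans (h i k)); near: n; exact: (near_infty_natSinv_lt (PosNum r0)).
have zd i j : agent_dist (z n) i j @[n --> \oo] --> agent_dist y i j.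
  apply/cvgrPdist_le => r r0; near=> n; rewrite distrC; have [_ h] := Hz n.
  apply: (le_trans (agent_dist_lip _ _ _ _)).
  have := nrm_le_coord (h i); have := nrm_le_coord (h j).
  have : n.+1%:R^-1 < r / 4.
    by near: n; exact: (near_infty_natSinv_lt (PosNum (divr_gt0 r0 (ltr0n R 4)))).
  by move: (n.+1%:R^-1 : R) => w; lra.
have ypos i j : i != j -> 0 < agent_dist y i j.
  move=> ij; rewrite lt0r agent_dist_ge0 andbT; apply/eqP => d0; apply: nd.
  exists i, j; split=> // k; apply/eqP; rewrite -subr_eq0 -normr_le0 -d0 agent_dist_nrm.
  exact: (coord_le_nrm (fun k => y i k - y j k)).
have N1 : \forall n \near \oo, forall i j, i != j -> 0 < agent_dist (z n) i j.
  apply: filter_forall => i; apply: filter_forall => j.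
  have [->|ij] := eqVneq i j; first by near=> n.
  near=> n; move=> _; near: n.
  exact: (cvgr_gt _ (zd i j) _ (ypos i j ij)).
have N2 : \forall n \near \oo, forall i j k, [/\ j != k, j != i & k != i] ->
    agent_dist (z n) i j - agent_dist (z n) i k != 0.
  apply: filter_forall => i; apply: filter_forall => j; apply: filter_forall => k.
  have [hc|hc] := pselect [/\ j != k, j != i & k != i]; last by near=> n.
  have hne : agent_dist y i j - agent_dist y i k != 0.
    rewrite subr_eq0; apply/eqP => e1; apply: ns; exists i, j, k.
    by case: hc.
  near=> n; move=> _; near: n.
  exact: (cvgr_neq0 _ (cvgB (zd i j) (zd i k)) hne).
have N3 : \forall n \near \oo, forall i l, l != i -> l != c i ->
    0 < agent_dist (z n) i l - agent_dist (z n) i (c i).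
  apply: filter_forall => i; apply: filter_forall => l.
  have [hc|hc] := pselect (l != i /\ l != c i); last by near=> n; move=> h1 h2; case: hc.
  have hgt : 0 < agent_dist y i l - agent_dist y i (c i).
    by rewrite subr_gt0; have [_] := cP i; case: hc => h1 h2; apply.
  near=> n; move=> _ _; near: n.
  exact: (cvgr_gt _ (cvgB (zd i l) (zd i (c i))) _ hgt).
have N4 : \forall n \near \oo, forall i k, `|f_formula xi (z n) c i k - u i k| <= e.
  apply: filter_forall => i; apply: filter_forall => k; rewrite uE.
  have : f_formula xi (z n) c i k @[n --> \oo] --> f_formula xi y c i k.
    have ci : i != c i by have [h _] := cP i; rewrite eq_sym.
    apply: cvgB; first exact: cvgB.
    apply: cvgM; first by apply: cvgM; [exact: cvg_cst|exact: cvgB].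
    apply: cvgV; first by rewrite expf_neq0// gt_eqF// ypos.
    by rewrite expr2; under eq_fun do rewrite expr2; exact: cvgM.
  move=> /cvgrPdist_le /(_ _ e0); apply: filterS => n; by rewrite distrC.
near \oo => n.
exists (z n), (f_formula xi (z n) c); split.
- split; first move=> [i [j [ij hij]]].
    have : 0 < agent_dist (z n) i j by move: i j ij {hij}; near: n.
    by rewrite agent_distE !hij !subrr expr0n/= addr0 sqrtr0 ltxx.
  split; first move=> [i [j [k [h1 h2 h3 h4]]]].
    have : agent_dist (z n) i j - agent_dist (z n) i k != 0.
      have : [/\ j != k, j != i & k != i] by [].
      by move: i j k {h1 h2 h3 h4}; near: n.
    by rewrite h4 subrr eqxx.
  exists c; split=> // i; split; first by have [] := cP i.
  by move=> l li lc; rewrite -subr_gt0; move: i l li lc; near: n.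
- by have [] := Hz n.
- move=> i k; have [_ h] := Hz n; apply: (le_trans (h i k)); apply: ltW.
  by near: n; exact: (near_infty_natSinv_lt (PosNum e0)).
- by near: n.
Unshelve. all: by end_near. Qed.

End avoiding_null_sets.

Section euler_limit.
Context {R : realType}.

Lemma ultra_cvg (U : set_system nat) (UF : UltraFilter U) (u : nat -> R) (M : R) :
  U [set n | `|u n| <= M] -> exists l : R, u n @[n --> U] --> l.
Proof.
move=> UM.
have UP : ProperFilter U by exact: ultra_proper.
have [l [_ cl]] : `[- M, M]%classic `&` cluster (u @ U) !=set0.
  apply: segment_compact; rewrite /fmap /=; apply: filterS UM => n /=.
  by rewrite in_itv/= ler_norml.
exists l => B Bl.
have [//|h] := in_ultra_setVsetC (u @^-1` B) UF.
by have [z []] := cl (~` B) B h Bl.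
Qed.

Variables (N : nat) (xi m1 M0 C : R) (x0 : config R N).
Hypotheses (N_gt1 : (2 <= N)%N) (m1_gt0 : 0 < m1) (M0_ge0 : 0 <= M0) (C_gt0 : 0 < C).
Variables (h : nat -> R) (xs ys us : nat -> nat -> config R N).
Hypotheses (h_gt0 : forall n, 0 < h n) (h_le : forall n, h n <= n.+1%:R^-1).
Hypothesis xs0 : forall n, xs n 0%N = x0.
Hypothesis x0_le : forall i l, `|x0 i l| <= M0.
Hypothesis scheme : forall n k, k%:R * h n <= n.+1%:R ->
    [/\ xs n k.+1 = cfg_move (xs n k) (h n) (us n k), f_graph xi (ys n k) (us n k),
      forall i l, `|ys n k i l - xs n k i l| <= n.+1%:R^-1,
      forall i l, `|us n k i l| <= 2 * (M0 + C * (k%:R * h n)) + C &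
      (forall i l, `|xs n k i l| <= M0 + C * (k%:R * h n)) /\
      (forall i j, j != i -> m1 <= agent_dist (xs n k) i j)].
Variable U : set_system nat.
Hypothesis UF : UltraFilter U.
Hypothesis U_oo : nbhs \oo `<=` U.

Let step n (t : R) := Num.truncn (t / h n).
Let X n (t : R) := xs n (step n t).
Let Lam (T : R) := 2 * (M0 + C * T) + C.

Let UP : ProperFilter U. Proof. exact: ultra_proper. Qed.

Lemma stepP n t : 0 <= t -> (step n t)%:R * h n <= t < (step n t)%:R * h n + h n.
Proof.
move=> t0; have th : 0 <= t / h n by rewrite divr_ge0// ltW.
have := truncn_itv th; rewrite ler_pdivlMr// ltr_pdivrMr// -/(step n t) -natr1 mulrDl mul1r.
by [].
Qed.

Lemma step_le n s t : s <= t -> (step n s <= step n t)%N.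
Proof. by move=> st; apply: le_truncn; rewrite ler_pM2r// invr_gt0. Qed.

Lemma X_neg n t : t <= 0 -> X n t = x0.
Proof.
move=> t0; rewrite /X (_ : step n t = 0%N) ?xs0//.
apply/eqP; rewrite -leqn0 -[leqRHS](truncn0 R); apply: le_truncn.
by rewrite pmulr_lle0 ?invr_gt0.
Qed.

Lemma X_le n t i l : t <= n.+1%:R -> `|X n t i l| <= M0 + C * Num.max 0 t.
Proof.
move=> tn; have [t0|/ltW t0] := leP 0 t.
  have /andP[h1 _] := stepP n t0.
  have [_ _ _ _ [h2 _]] := scheme (le_trans h1 tn).
  by apply: (le_trans (h2 i l)); rewrite lerD2l ler_pM2l.
by rewrite X_neg// mulr0 addr0.
Qed.

Lemma Lam_ge0 T : 0 <= T -> 0 < Lam T.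
Proof. by move=> T0; rewrite ltr_wpDl// mulr_ge0// addr_ge0// mulr_ge0// ltW. Qed.

Lemma Lam_le T T' : T <= T' -> Lam T <= Lam T'.
Proof. by move=> TT; rewrite lerD2r ler_pM2l// lerD2l ler_pM2l. Qed.

Lemma us_le n k T i l : k%:R * h n <= T -> T <= n.+1%:R -> `|us n k i l| <= Lam T.
Proof.
move=> kT Tn; have [_ _ _ h1 _] := scheme (le_trans kT Tn).
exact: le_trans (h1 i l) (Lam_le kT).
Qed.

Lemma xs_sub n a b i l : (a <= b)%N -> b%:R * h n <= n.+1%:R ->
  xs n b i l - xs n a i l = h n * \sum_(a <= k < b) us n k i l.
Proof.
move=> /subnK <-; elim: (b - a)%N => [|c IH] hb.
  by rewrite subrr big_geq// mulr0.
have hc : (c + a)%:R * h n <= n.+1%:R.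
  by apply: le_trans hb; rewrite ler_pM2r// ler_nat leq_add2r.
rewrite addSn big_nat_recr/=; last by rewrite leq_addl.
have [-> _ _ _ _] := scheme hc; rewrite mulrDr -IH// /cfg_move; ring.
Qed.

Lemma xs_lip n a b T i l : (a <= b)%N -> b%:R * h n <= T -> T <= n.+1%:R ->
  `|xs n b i l - xs n a i l| <= Lam T * ((b%:R - a%:R) * h n).
Proof.
move=> ab bT Tn; rewrite xs_sub ?(le_trans bT)// normrM gtr0_norm// mulrC mulrA ler_pM2r//.
apply: (le_trans (ler_norm_sum _ _ _)).
apply: (@le_trans _ _ (\sum_(a <= k < b) Lam T)).
  rewrite big_nat [leRHS]big_nat; apply: ler_sum => k /andP[_ kb]; apply: us_le Tn.
  by apply: le_trans bT; rewrite ler_pM2r// ler_nat ltnW.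
by rewrite sumr_const_nat -[leLHS]mulr_natr natrB.
Qed.

Lemma step_sub n s t : 0 <= s -> s <= t ->
  t - s - h n <= ((step n t)%:R - (step n s)%:R) * h n <= t - s + h n.
Proof.
move=> s0 st; have /andP[? ?] := stepP n s0.
have /andP[? ?] := stepP n (le_trans s0 st).
by rewrite mulrBl; apply/andP; split; lra.
Qed.

Lemma X_lip n s t i l : 0 <= s -> s <= t -> t <= n.+1%:R ->
  `|X n t i l - X n s i l| <= Lam t * (t - s + h n).
Proof.
move=> s0 st tn; have t0 := le_trans s0 st.
have /andP[h1 _] := stepP n t0; apply: (le_trans (xs_lip _ _ (step_le n st) h1 tn)).
by rewrite ler_pM2l ?Lam_ge0//; have /andP[] := step_sub n s0 st.
Qed.

Lemma U_natSinv (e : R) : 0 < e -> U [set n | n.+1%:R^-1 < e].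
Proof. by move=> e0; apply: U_oo; exact: (near_infty_natSinv_lt (PosNum e0)). Qed.

Lemma U_ge (T : R) : U [set n | T <= n.+1%:R].
Proof.
apply: U_oo; exists (Num.truncn T) => // n /= Tn.
by apply: ltW; apply: lt_le_trans (truncnS_gt T) _; rewrite ler_nat ltnS.
Qed.

Lemma X_cvg t i l : exists z : R, X n t i l @[n --> U] --> z.
Proof.
apply: (@ultra_cvg _ _ _ (M0 + C * Num.max 0 t)).
by apply: filterS (U_ge t) => n /=; exact: X_le.
Qed.

Definition euler_limit (t : R) : config R N := fun i l => sval (cid (X_cvg t i l)).

Let x := euler_limit.

Lemma X_near t (e : R) : 0 < e -> U [set n | forall i l, `|X n t i l - x t i l| <= e].
Proof.
move=> e0; apply: filter_forall => i; apply: filter_forall => l.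
have := svalP (cid (X_cvg t i l)) => /cvgrPdist_le /(_ _ e0).
by apply: filterS => n /=; rewrite distrC.
Qed.

Lemma euler_limit0 : x 0 = x0.
Proof.
apply/funext => i; apply/funext => l; apply/eqP; rewrite -subr_eq0 -normr_le0.
apply/ler_addgt0Pl => e e0; rewrite addr0.
have [n /= /(_ i l)] := filter_ex (X_near 0 e0).
by rewrite X_neg// distrC.
Qed.

Lemma euler_limit_lip s t i l : 0 <= s -> s <= t -> `|x t i l - x s i l| <= Lam t * (t - s).
Proof.
move=> s0 st; have t0 := le_trans s0 st; have L0 := Lam_ge0 t0.
apply/ler_addgt0Pl => e e0.
have e1 : 0 < e / (4 * Lam t) by rewrite divr_gt0// mulr_gt0.
have e4 : 0 < e / 4 by rewrite divr_gt0.
have [n /= [[/(_ i l) h1 /(_ i l) h2] [h3 tn]]] :=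
  filter_ex (filterI (filterI (X_near t e4) (X_near s e4)) (filterI (U_natSinv e1) (U_ge t))).
have h4 := X_lip i l s0 st tn.
have h5 : Lam t * h n <= e / 4.
  have -> : e / 4 = Lam t * (e / (4 * Lam t)) by field; rewrite gt_eqF.
  by rewrite ler_pM2l// (le_trans (h_le n))// ltW.
move: h1 h2 h4; rewrite !ler_norml => /andP[? ?] /andP[? ?] /andP[? ?].
by apply/andP; split; lra.
Qed.

Lemma euler_limit_nondegenerate t : 0 <= t -> ~ degenerate (x t).
Proof.
move=> t0 [i [j [ij xij]]].
have e0 : 0 < m1 / 8 by rewrite divr_gt0.
have [n /= [h1 tn]] := filter_ex (filterI (X_near t e0) (U_ge t)).
have /andP[h2 _] := stepP n t0.
have [_ _ _ _ [_ /(_ i j)]] := scheme (le_trans h2 tn); rewrite eq_sym ij => /(_ isT).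
rewrite -/(X n t) agent_dist_nrm.
have h3 k : `|X n t i k - X n t j k| <= m1 / 4.
  have := h1 i k; have := h1 j k; rewrite -(xij k) !ler_norml => /andP[? ?] /andP[? ?].
  by apply/andP; split; lra.
have := nrm_le_coord h3; lra.
Qed.

Lemma euler_limit_abs_cont T i l : 0 < T -> abs_cont_on 0 T (fun t => x t i l).
Proof.
move=> T0 e e0; have L0 := Lam_ge0 (ltW T0); exists (e / Lam T); first by rewrite divr_gt0.
move=> n s t st _ small.
apply: (@le_lt_trans _ _ (\sum_(j < n) Lam T * (t j - s j))).
  apply: ler_sum => j _; have [s0 [sj tT]] := st j.
  apply: (le_trans (euler_limit_lip i l s0 sj)).
  by apply: ler_wpM2r; [rewrite subr_ge0|exact: Lam_le].
by rewrite -mulr_sumr mulrC -ltr_pdivlMr.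
Qed.

Lemma euler_limit_ae_derivable :
  {ae (@lebesgue_measure R), forall t, 0 < t -> forall i l, derivable (fun s => x s i l) t 1}.
Proof.
have H (i : 'I_N) (l : 'I_2) (n : nat) :
    {ae (@lebesgue_measure R), forall t, 0 < t < n.+1%:R -> derivable (fun s => x s i l) t 1}.
  pose cl (s : R) : R := Num.max 0 (Num.min s n.+1%:R).
  have cl0 s : 0 <= cl s by rewrite le_max lexx.
  have cln s : cl s <= n.+1%:R by rewrite ge_max ler0n ge_min lexx orbT.
  have cll s t : s <= t -> cl s <= cl t /\ cl t - cl s <= t - s.
    move=> st; have n0 : 0 <= n.+1%:R :> R by [].
    move: n.+1%:R n0 @cl cl0 cln => nn n0 cl _ _; rewrite /cl.
    case: (leP s nn) => ?; case: (leP t nn) => ?; rewrite !maxEle;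
    by split; repeat (case: ifPn; rewrite -?ltNge => ?); lra.
  pose g s := x (cl s) i l.
  have L0 : 0 < Lam n.+1%:R by exact: Lam_ge0.
  have gl s t : s <= t -> `|g s - g t| <= Lam n.+1%:R * `|s - t|.
    move=> st; have [c1 c2] := cll s t st; rewrite distrC.
    apply: (le_trans (euler_limit_lip i l (cl0 s) c1)).
    apply: (@le_trans _ _ (Lam n.+1%:R * (cl t - cl s))).
      by apply: ler_wpM2r; [rewrite subr_ge0|exact: Lam_le].
    by rewrite ler_pM2l// distrC ger0_norm// subr_ge0.
  have gL s t : `|g s - g t| <= Lam n.+1%:R * `|s - t|.
    have [/gl//|/ltW ts] := leP s t.
    by rewrite distrC (distrC s); exact: gl.
  have := lipschitz_ae_derivable n.+1%:R L0 gL.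
  apply: filterS; first exact: (ae_filter_ringOfSetsType (@lebesgue_measure R)).
  move=> t /= Ht tn; have := Ht tn; apply: near_eq_derivable.
  move: tn => /andP[t0 tn]; near=> s; rewrite /g; congr (x _ i l).
  have s0 : 0 < s by near: s; exact: lt_nbhsr.
  have sn : s < n.+1%:R by near: s; exact: lt_nbhsl.
  by rewrite /cl minEle (ltW sn) maxEle (ltW s0).
have FF := ae_filter_ringOfSetsType (@lebesgue_measure R).
have Hn (n : nat) : {ae (@lebesgue_measure R), forall t, forall (i : 'I_N) (l : 'I_2),
    0 < t < n.+1%:R -> derivable (fun s => x s i l) t 1}.
  by apply: filter_forall => i; apply: filter_forall => l; exact: H.
have := ae_foralln Hn.
apply: filterS => t /= Ht t0 i l; apply: (Ht (Num.truncn t)).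
by rewrite t0 truncnS_gt.
Unshelve. all: by end_near. Qed.


Lemma euler_velocity_avoid (L : set (config R N)) (e : R) n k : cfg_null L -> 0 < e ->
  k%:R * h n <= n.+1%:R ->
  exists yu : config R N * config R N, [/\ f_graph xi yu.1 yu.2, ~ L yu.1,
    forall i l, `|yu.1 i l - xs n k i l| <= n.+1%:R^-1 + e &
    forall i l, `|yu.2 i l - us n k i l| <= e].
Proof.
move=> nL e0 kn; have [_ fg yx _ _] := scheme kn.
have [y' [u' [h1 h2 h3 h4]]] := f_graph_avoid nL e0 fg.
exists (y', u'); split=> // i l /=; rewrite [leRHS]addrC.
rewrite (_ : y' i l - _ = (y' i l - ys n k i l) + (ys n k i l - xs n k i l)); last by ring.
by apply: (le_trans (ler_normD _ _)); rewrite lerD.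
Qed.

Lemma derive_quotient_near (t : R) (v : config R N) (e r : R) : 0 < e -> 0 < r ->
  (forall i l, is_derive t 1 (fun s => x s i l) (v i l)) ->
  exists2 tau, 0 < tau <= r & forall i l, `|(x (t + tau) i l - x t i l) / tau - v i l| <= e.
Proof.
move=> e0 r0 dv.
have H : \forall d \near 0^', forall i l,
    `|v i l - d^-1 *: (x (d *: 1 + t) i l - x t i l)| <= e.
  apply: filter_forall => i; apply: filter_forall => l.
  have [df dfE] := dv i l; move: df => /cvg_ex[z Hz].
  have zE : z = v i l by rewrite -dfE; apply/esym/cvg_lim.
  by move: Hz; rewrite zE => /cvgrPdist_le /(_ _ e0).
move: H => [d /= d0 Hd].
pose tau := Num.min r (d / 2).
have tau0 : 0 < tau by rewrite lt_min r0 divr_gt0.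
exists tau; first by rewrite tau0 ge_min lexx.
move=> i l; have := Hd tau; rewrite /ball_ /= sub0r normrN gtr0_norm//.
have -> : tau < d by rewrite gt_min; apply/orP; right; rewrite ltr_pdivrMr// ltr_pMr// ltr1n.
move=> /(_ isT); rewrite gt_eqF// => /(_ isT i l).
by rewrite distrC /GRing.scale/= mulr1 [tau + t]addrC [tau^-1 * _]mulrC.
Qed.

Lemma euler_limit_Kf (t : R) (v : config R N) : 0 < t ->
  (forall i l, is_derive t 1 (fun s => x s i l) (v i l)) -> Kf xi (x t) v.
Proof.
move=> t0 dv delta delta0 L nL eps eps0.
have N0 : (0 < N)%N by exact: ltnW.
have NN : 0 < (2 * N)%:R :> R by rewrite ltr0n muln_gt0.
pose e := eps / ((2 * N)%:R * 2); pose dl := delta / ((2 * N)%:R * 2).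
have e0 : 0 < e by rewrite divr_gt0// mulr_gt0.
have dl0 : 0 < dl by rewrite divr_gt0// mulr_gt0.
have eE : (2 * N)%:R * e = eps / 2 by rewrite /e; move: (2 * N)%:R NN => c c0; field; rewrite gt_eqF.
have dlE : (2 * N)%:R * dl = delta / 2 by rewrite /dl; move: (2 * N)%:R NN => c c0; field; rewrite gt_eqF.
clearbody e dl.
pose LT := Lam (t + 1).
have LT0 : 0 < LT by apply: Lam_ge0; lra.
pose r := Num.min 1 (dl / (8 * LT)).
have r0 : 0 < r by rewrite lt_min ltr01 divr_gt0// mulr_gt0.
have e4 : 0 < e / 4 by rewrite divr_gt0.
have [tau /andP[tau0 taur] Htau] := derive_quotient_near e4 r0 dv.
have tau1 : tau <= 1 by apply: (le_trans taur); rewrite ge_min lexx.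
have tauL : LT * tau <= dl / 8.
  have : tau <= dl / (8 * LT) by apply: (le_trans taur); rewrite ge_min lexx orbT.
  by rewrite ler_pdivlMr ?mulr_gt0//; lra.
pose e1 := Num.min (e * tau / 16) (dl / 8).
have e10 : 0 < e1 by rewrite lt_min !divr_gt0// mulr_gt0.
have [e1e e1d] : e1 <= e * tau / 16 /\ e1 <= dl / 8 by split; rewrite ge_min lexx ?orbT.
pose b := Num.min (tau / 2) (Num.min (tau * e / (16 * LT)) (Num.min (dl / (8 * LT)) (dl / 8))).
have b0 : 0 < b by rewrite !lt_min !divr_gt0// ?mulr_gt0.
have [b1 b2 b3 b4] : [/\ b <= tau / 2, b <= tau * e / (16 * LT), b <= dl / (8 * LT) & b <= dl / 8].
  by split; rewrite /b !ge_min lexx ?orbT.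
have [n /= [[Xt Xtau] [nb nt]]] := filter_ex
  (filterI (filterI (X_near t e10) (X_near (t + tau) e10)) (filterI (U_natSinv b0) (U_ge (t + 1)))).
have hb : h n <= b by apply: (le_trans (h_le n)); exact: ltW.
have ht : h n <= tau / 2 by exact: le_trans hb b1.
have he : LT * h n <= tau * e / 16.
  have := le_trans hb b2; rewrite ler_pdivlMr ?mulr_gt0//; lra.
have hd : LT * h n <= dl / 8.
  have := le_trans hb b3; rewrite ler_pdivlMr ?mulr_gt0//; lra.
have nd : n.+1%:R^-1 <= dl / 8 by exact: le_trans (ltW nb) b4.
pose K1 := step n t; pose K2 := step n (t + tau).
have tle : t <= t + tau by lra.
have K12 : (K1 <= K2)%N by exact: step_le.
pose D := (K2 - K1)%N.
have /andP[s1 s2] := step_sub n (ltW t0) tle.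
have DE : D%:R = K2%:R - K1%:R :> R by rewrite natrB.
pose s := D%:R * h n.
have [st1 st2] : tau - h n <= s /\ s <= tau + h n by rewrite /s DE; split; lra.
have D0 : 0 < D%:R :> R by rewrite -(pmulr_lgt0 _ (h_gt0 n)) -/s; have := h_gt0 n; lra.
have /andP[K2t _] := stepP n (le_trans (ltW t0) tle).
have jk (j : 'I_D) : (j + K1)%:R * h n <= t + tau.
  apply: le_trans K2t; rewrite ler_pM2r// ler_nat.
  by rewrite -/K2 -(subnK K12) leq_add2r ltnW.
have tn : t + tau <= n.+1%:R by apply: le_trans nt; lra.
pose e2 := Num.min (e / 4) (dl / 4).
have e20 : 0 < e2 by rewrite lt_min !divr_gt0.
have [e2e e2d] : e2 <= e / 4 /\ e2 <= dl / 4 by split; rewrite ge_min lexx ?orbT.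
have [F HF] := choice (fun j : 'I_D => euler_velocity_avoid nL e20 (le_trans (jk j) tn)).
pose ub : config R N := fun i l => \sum_(j < D) D%:R^-1 * (F j).2 i l.
exists ub; split.
  exists D, (fun j => (F j).2), (fun=> D%:R^-1); split=> //.
  - move=> j; exists (F j).1; have [h1 h2 h3 h4] := HF j; split=> //.
    rewrite /cfg_ball /=; apply: (@le_lt_trans _ _ ((2 * N)%:R * dl)); last by rewrite dlE; lra.
    apply: cfg_norm_le => // i l; rewrite /cfg_sub.
    have h5 : `|xs n (j + K1) i l - xs n K1 i l| <= LT * (tau + h n).
      apply: (le_trans (xs_lip i l (leq_addl _ _) (jk j) tn)).
      apply: ler_pM => //; first by rewrite ltW// Lam_ge0//; lra.
      - by rewrite mulr_ge0 ?(ltW (h_gt0 n))// subr_ge0 ler_nat leq_addl.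
      - by apply: Lam_le; lra.
      apply: le_trans st2; rewrite /s natrD addrK ler_pM2r// ler_nat.
      exact/ltnW/ltn_ord.
    have h6 : `|(F j).1 i l - xs n (j + K1) i l| <= dl / 8 + dl / 4.
      by apply: (le_trans (h3 i l)); exact: lerD.
    have h7 : `|xs n K1 i l - x t i l| <= dl / 8 by exact: le_trans (Xt i l) e1d.
    move: h5 h6 h7; rewrite !ler_norml => /andP[? ?] /andP[? ?] /andP[? ?].
    by apply/andP; split; lra.
  - by rewrite sumr_const card_ord -[LHS]mulr_natl divff// gt_eqF.
apply: (@le_lt_trans _ _ ((2 * N)%:R * e)); last by rewrite eE; lra.
apply: cfg_norm_le => // i l; rewrite /cfg_sub.
pose mu := D%:R^-1 * \sum_(j < D) us n (j + K1) i l.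
have umu : `|ub i l - mu| <= e / 4.
  rewrite /ub /mu mulr_sumr -sumrB.
  apply: (le_trans (ler_norm_sum _ _ _)); apply: (@le_trans _ _ (\sum_(j < D) D%:R^-1 * (e / 4))).
    apply: ler_sum => j _; rewrite -mulrBr normrM gtr0_norm ?invr_gt0// ler_pM2l ?invr_gt0//.
    by have [_ _ _ h4] := HF j; apply: (le_trans (h4 i l)).
  by rewrite sumr_const card_ord -[leLHS]mulr_natl mulrA divff ?mul1r// gt_eqF.
have muL : `|mu| <= LT.
  rewrite /mu normrM gtr0_norm ?invr_gt0// mulrC ler_pdivrMr//.
  apply: (le_trans (ler_norm_sum _ _ _)); apply: (@le_trans _ _ (\sum_(j < D) LT)).
    apply: ler_sum => j _; apply: (le_trans (us_le i l (jk j) tn)).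
    by apply: Lam_le; lra.
  by rewrite sumr_const card_ord -[leLHS]mulr_natr.
have XE : X n (t + tau) i l - X n t i l = s * mu.
  rewrite /X xs_sub//; last exact: le_trans K2t tn.
  rewrite -/K1 -/K2 -{1}[K1]add0n big_addn big_mkord /s /mu -/D.
  by field; rewrite gt_eqF.
have m1' : `|(s - tau) * mu| <= tau * e / 16.
  rewrite normrM; apply: (@le_trans _ _ (h n * LT)); last by rewrite mulrC.
  by apply: ler_pM => //; rewrite ler_norml; apply/andP; split; lra.
have h5 := Htau i l.
have h6 : `|(x (t + tau) i l - x t i l) - tau * v i l| <= tau * (e / 4).
  rewrite (_ : _ - _ = tau * ((x (t + tau) i l - x t i l) / tau - v i l)).
    by rewrite normrM gtr0_norm// ler_pM2l.
  by field; rewrite gt_eqF.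
have h7 : `|tau * (mu - v i l)| <= tau * (e * 3 / 4).
  have := Xt i l; have := Xtau i l; move: h6 m1' XE.
  rewrite mulrBr mulrBl !ler_norml => /andP[? ?] /andP[? ?] ? /andP[? ?] /andP[? ?].
  by apply/andP; split; lra.
move: h7; rewrite normrM gtr0_norm// ler_pM2l// => h7.
rewrite (_ : _ - _ = (ub i l - mu) + (mu - v i l)); last by ring.
by apply: (le_trans (ler_normD _ _)); lra.
Qed.

End euler_limit.

Theorem mainTheorem1 (R : realType) (N : nat) (xi : R) (x0 : config R N) :
  (2 <= N)%N -> 0 < xi -> ~ degenerate x0 ->
  exists x : R -> config R N,
    [/\ filippov_solution xi x, x 0 = x0 &
        forall t : R, 0 < t -> ~ degenerate (x t)].
Proof.
move=> N2 xi0 nd0.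
have [i0 [j0 [ji0 dmin]]] := min_agent_dist x0 N2.
have d0 : 0 < agent_dist x0 i0 j0.
  rewrite lt0r agent_dist_ge0 andbT; apply/eqP => d0; apply: nd0.
  exists i0, j0; rewrite eq_sym; split=> // k; apply/eqP.
  rewrite -subr_eq0 -normr_le0 -d0 agent_dist_nrm.
  exact: (coord_le_nrm (fun k => x0 i0 k - x0 j0 k)).
pose ms := Num.min (agent_dist x0 i0 j0) xi.
have ms0 : 0 < ms by rewrite lt_min d0.
have msxi : ms <= xi by rewrite ge_min lexx orbT.
have dx0 i j : j != i -> ms <= agent_dist x0 i j.
  by move=> ji; apply: le_trans (dmin i j ji); rewrite ge_min lexx.
pose M0 := cfg_norm x0.
have M00 : 0 <= M0 by exact: sqrtr_ge0.
have x0M i l : `|x0 i l| <= M0.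
  rewrite -sqrtr_sqr ler_wsqrtr// (bigD1 i)//= (bigD1 l)//= -addrA lerDl addr_ge0//.
    by apply: sumr_ge0 => k _; exact: sqr_ge0.
  by apply: sumr_ge0 => k _; apply: sumr_ge0 => k' _; exact: sqr_ge0.
pose m1 := ms / 2; pose C := 2 + 2 * xi ^+ 2 / m1.
have m10 : 0 < m1 by rewrite divr_gt0.
have C0 : 0 < C by rewrite addr_gt0// divr_gt0// mulr_gt0// exprn_gt0.
have H (n : nat) : exists z : R * ((nat -> config R N) * (nat -> config R N) * (nat -> config R N)),
    [/\ 0 < z.1, z.1 <= n.+1%:R^-1, z.2.1.1 0%N = x0 & forall k : nat, k%:R * z.1 <= n.+1%:R ->
    [/\ z.2.1.1 k.+1 = cfg_move (z.2.1.1 k) z.1 (z.2.2 k), f_graph xi (z.2.1.2 k) (z.2.2 k),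
      forall i l, `|z.2.1.2 k i l - z.2.1.1 k i l| <= n.+1%:R^-1,
      forall i l, `|z.2.2 k i l| <= 2 * (M0 + C * (k%:R * z.1)) + C &
      (forall i l, `|z.2.1.1 k i l| <= M0 + C * (k%:R * z.1)) /\
      (forall i j, j != i -> m1 <= agent_dist (z.2.1.1 k) i j)]].
  have n0 : 0 < n.+1%:R :> R by rewrite ltr0n.
  have n0' : 0 < n.+1%:R^-1 :> R by rewrite invr_gt0.
  have [h [xs [ys [us Hs]]]] := euler_scheme N2 xi0 n0 n0' ms0 msxi dx0 M00 x0M.
  by exists (h, (xs, ys, us)).
have [z Hz] := choice H.
have [U [UF U_oo]] := @ultraFilterLemma nat (nbhs \oo) _.
have hp n : 0 < (z n).1 by have [] := Hz n.
have hl n : (z n).1 <= n.+1%:R^-1 by have [] := Hz n.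
have h0 n : (z n).2.1.1 0%N = x0 by have [] := Hz n.
have sch n := let: And4 _ _ _ s := Hz n in s.
pose x := euler_limit C0 hp h0 x0M sch UF U_oo.
exists x; split.
- split; first by move=> T T0 i k; exact: euler_limit_abs_cont.
  exists (~` [set t | 0 < t -> forall i l, derivable (fun s => x s i l) t 1]); split.
    exact: euler_limit_ae_derivable.
  move=> t t0 nZ.
  have dt i l : derivable (fun s => x s i l) t 1.
    by apply: contrapT => nd; apply: nZ => /= H'; exact: nd (H' t0 i l).
  exists (fun i l => 'D_1 (fun s => x s i l) t).
  have dx i l : is_derive t 1 (fun s => x s i l) ('D_1 (fun s => x s i l) t).
    exact: derivableP.
  by split=> //; exact: (euler_limit_Kf N2 M00 hl t0 dx).
- exact: euler_limit0.
- by move=> t t0; apply: (euler_limit_nondegenerate m10); exact: ltW.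
Qed.
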